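(* Let $p\ge 1$ be an integer and let $f:\mathbb{R}^n\to\mathbb{R}\cup\{+\infty\}$ be a lower semicontinuous function whose graph is closed and admits a $C^p$-Whitney stratification $\mathcal S=(S_i)_{i\in I}$ such that $e_{n+1}\notin T_uS_i$ for all $i\in I$ and $u\in S_i$, where $e_{n+1}=(0,\dots,0,1)\in\mathbb{R}^{n+1}$. For $x\in\mathrm{dom}\,f$ let $S_x$ be the stratum of $\mathcal S$ containing $(x,f(x))$, let $X_x=\Pi(S_x)$ be its projection to $\mathbb{R}^n$, and let $\nabla_Rf(x)\in T_xX_x$ be the gradient at $x$ of $f|_{X_x}$. Then: (i) for all $x$ with $\partial^\circ f(x)\neq\emptyset$ and all $x^*\in\partial^\circ f(x)$, $$\|\nabla_Rf(x)\|\le\|x^*\|.$$ (ii) (Morse-Sard theorem) If $p\ge n$, then the set of Clarke critical values of $f$ has Lebesgue measure $0$ in $\mathbb{R}$.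
   Context: $\mathbb{R}^n$ carries its canonical scalar product. For $f:\mathbb{R}^n\to\mathbb{R}\cup\{+\infty\}$: $\mathrm{dom}\,f=\{x: f(x)<+\infty\}$, $\mathrm{Graph}\,f=\{(x,f(x)):x\in\mathrm{dom}\,f\}\subset\mathbb{R}^n\times\mathbb{R}$; $f$ is lower semicontinuous if its epigraph $\{(x,\beta)\in\mathbb{R}^n\times\mathbb{R}:f(x)\le\beta\}$ is closed. Subdifferentials. For $x\in\mathrm{dom}\,f$, the Fréchet subdifferential $\hat\partial f(x)$ is the set of $x^*\in\mathbb{R}^n$ with $\liminf_{y\to x,\,y\ne x}\frac{f(y)-f(x)-\langle x^*,y-x\rangle}{\|y-x\|}\ge 0$. The limiting subdifferential $\partial f(x)$ is the set of $p$ for which there exist sequences $x_k$ and $x_k^*\in\hat\partial f(x_k)$ with $x_k\to x$, $f(x_k)\to f(x)$, $x_k^*\to p$. The asymptotic limiting subdifferential $\partial^\infty f(x)$ is the set of $q$ for which there exist $y_k$, $y_k^*\in\hat\partial f(y_k)$ and positive $t_k\searrow 0$ with $y_k\to x$, $f(y_k)\to f(x)$, $t_ky_k^*\to q$. The Clarke subdifferential is $\partial^\circ f(x)=\overline{\mathrm{co}}\,(\partial f(x)+\partial^\infty f(x))$ (closed convex hull of the Minkowski sum; it is empty if $\partial f(x)=\emptyset$). All these sets are empty if $x\notin\mathrm{dom}\,f$. A point $x$ is a Clarke critical point of $f$ if $0\in\partial^\circ f(x)$; $\alpha\in\mathbb{R}$ is a Clarke critical value of $f$ if $f^{-1}(\{\alpha\})$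 contains a Clarke critical point. Stratifications. A $C^p$ stratification ($p\ge1$ an integer) of a set $X\subset\mathbb{R}^m$ is a locally finite partition $(X_i)_{i\in I}$ of $X$ into $C^p$ submanifolds of $\mathbb{R}^m$ (strata) such that for $i\ne j$, $\overline{X_i}\cap X_j\neq\emptyset$ implies $X_j\subset\overline{X_i}\setminus X_i$. It has the Whitney-(a) property if for all $i\neq j$, all $x\in\overline{X_i}\cap X_j$ and every sequence $(x_k)\subset X_i$ with $x_k\to x$ and $T_{x_k}X_i\to\mathcal T$, one has $T_xX_j\subset\mathcal T$. Convergence of subspaces is with respect to the gap $D(V,W)=\max\{\sup_{v\in V,\|v\|=1}d(v,W),\ \sup_{w\in W,\|w\|=1}d(w,V)\}$. A $C^p$-Whitney stratification is a $C^p$ stratification with the Whitney-(a) property. Projected strata. $\Pi:\mathbb{R}^{n+1}\to\mathbb{R}^n$, $\Pi(x_1,\dots,x_n,t)=(x_1,\dots,x_n)$. Since $\Pi$ is injective on $\mathrm{Graph}\,f$ and $e_{n+1}\notin T_uS_i$, each $X_i=\Pi(S_i)$ is regarded as a $C^p$ submanifold of $\mathbb{R}^n$ via the injective immersion $\Pi|_{S_i}$, with $T_xX_i=\Pi(T_{(x,f(x))}S_i)$, and $f|_{X_i}$ is a $C^p$ function on it. Each $X_i$ has the Riemannian metric induced by the Euclidean scalar product; $\nabla_Rf(x)$ is the unique vector of $T_xX_x$ such that $\langle\nabla_Rf(x),v\rangle=d(f|_{X_x})(x)(v)$ for all $v\in T_xX_x$. *)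

(* Defs.v *)
From HB Require Import structures.
From mathcomp Require Import all_boot all_order all_algebra.
From mathcomp Require Import all_classical all_reals all_analysis.

Set Implicit Arguments.
Unset Strict Implicit.
Unset Printing Implicit Defensive.

Import Order.TTheory GRing.Theory Num.Theory.
Import numFieldNormedType.Exports.

Local Open Scope classical_set_scope.
Local Open Scope ring_scope.

(* R^m is 'rV[R]_m.  Its library norm is the sup norm; it induces the usual
   topology and the usual notion of differentiability, but every norm that
   occurs in the mathematics below is the Euclidean one, enorm. *)
Definition dotp (R : realType) (m : nat) (u v : 'rV[R]_m) : R :=
  \sum_(i < m) u 0 i * v 0 i.

Definition enorm (R : realType) (m : nat) (u : 'rV[R]_m) : R :=
  Num.sqrt (dotp u u).

(* R^n x R is identified with 'rV[R]_(n + 1), the last coordinate being the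
   value; Pi is lsubmx and e_{n+1} is vertical R n. *)
Definition pt (R : realType) (n : nat) (x : 'rV[R]_n) (t : R) : 'rV[R]_(n + 1) :=
  row_mx x (t%:M : 'rV[R]_1).

Definition vertical (R : realType) (n : nat) : 'rV[R]_(n + 1) := pt 0 1.

Definition Pi (R : realType) (n : nat) (u : 'rV[R]_(n + 1)) : 'rV[R]_n :=
  lsubmx u.

Section ExtendedFunctions.
Variables (R : realType) (n : nat).
Implicit Types (f : 'rV[R]_n -> \bar R) (x : 'rV[R]_n).

Definition dom f : set 'rV[R]_n := [set x | (f x < +oo)%E].

Definition epigraph f : set 'rV[R]_(n + 1) :=
  [set u | exists x b, (f x <= b%:E)%E /\ u = pt x b].

Definition lsc f : Prop := closed (epigraph f).

(* The point (x, f x); only meaningful when f x is finite. *)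
Definition graph_pt f x : 'rV[R]_(n + 1) := pt x (fine (f x)).

Definition graph f : set 'rV[R]_(n + 1) := graph_pt f @` dom f.

Definition frechet_subdiff f x : set 'rV[R]_n :=
  [set p | dom f x /\
    (0 <= limf_einf (fun y => (f y - f x - (dotp p (y - x))%:E)
                                * ((enorm (y - x))^-1)%:E) x^')%E].

Definition limiting_subdiff f x : set 'rV[R]_n :=
  [set p | dom f x /\
    exists (u s : nat -> 'rV[R]_n),
      [/\ forall k, frechet_subdiff f (u k) (s k),
          u @ \oo --> x,
          (fun k => f (u k)) @ \oo --> f x &
          s @ \oo --> p]].

Definition asymptotic_subdiff f x : set 'rV[R]_n :=
  [set q | dom f x /\
    exists (y s : nat -> 'rV[R]_n) (t : nat -> R),
      [/\ forall k, frechet_subdiff f (y k) (s k),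
          [/\ forall k, 0 < t k, nonincreasing_seq t & t @ \oo --> (0 : R)],
          y @ \oo --> x,
          (fun k => f (y k)) @ \oo --> f x &
          (fun k => t k *: s k) @ \oo --> q]].

Definition convex_hull (A : set 'rV[R]_n) : set 'rV[R]_n :=
  [set x | exists (k : nat) (a : 'I_k -> R) (u : 'I_k -> 'rV[R]_n),
    [/\ forall i, 0 <= a i, \sum_(i < k) a i = 1, forall i, A (u i) &
        x = \sum_(i < k) a i *: u i]].

Definition clarke_subdiff f x : set 'rV[R]_n :=
  closure (convex_hull
    [set p + q | p in limiting_subdiff f x & q in asymptotic_subdiff f x]).

Definition clarke_critical_values f : set R :=
  [set a | exists x, f x = a%:E /\ clarke_subdiff f x 0].

End ExtendedFunctions.

(* g is of class C^k on the open set U; in finite dimension this is the usual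
   notion (all partial derivatives of order <= k exist and are continuous). *)
Fixpoint Ck_on (R : realType) (V W : normedModType R) (k : nat) (U : set V)
    (g : V -> W) {struct k} : Prop :=
  match k with
  | 0 => forall x, U x -> {for x, continuous g}
  | k'.+1 => (forall x, U x -> differentiable g x) /\
             (forall v : V, Ck_on k' U (fun x => 'D_v g x))
  end.

Section Stratifications.
Variables (R : realType) (m : nat).
Local Notation E := 'rV[R]_m.
Implicit Types (M : set E).

(* Embedded submanifold of (constant) dimension d: near each of its points, a
   C^p diffeomorphism phi : U -> W, with inverse psi, straightens M to
   R^d x {0}. *)
Definition submanifold (p : nat) (M : set E) : Prop :=
  exists2 d : nat, (d <= m)%N &
  forall x, M x -> exists (U W : set E) (phi psi : E -> E),
    [/\ open U, U x & open W] /\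
    [/\ forall y, U y -> W (phi y) /\ psi (phi y) = y,
        forall z, W z -> U (psi z) /\ phi (psi z) = z,
        Ck_on p U phi & Ck_on p W psi] /\
    forall y, U y -> (M y <-> forall j : 'I_m, (d <= j)%N -> phi y 0 j = 0).

Definition C1_curve (M : set E) (u : E) : set (R -> E) :=
  [set g | exists2 e : R, 0 < e &
    [/\ @Ck_on R R^o E 1 [set t : R^o | `|t| < e] g,
        forall t, `|t| < e -> M (g t) & g 0 = u]].

(* The tangent space T_u M: velocities of C^1 curves of M through u. *)
Definition tangent (M : set E) (u : E) : set E :=
  [set derive1 g 0 | g in C1_curve M u].

Definition dist_to (v : E) (W : set E) : R := inf [set enorm (v - w) | w in W].

(* sup set0 = 0 in the library, which is the convention needed for the
   subspace {0}. *)
Definition gap (V W : set E) : R :=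
  Num.max (sup [set dist_to v W | v in [set v | V v /\ enorm v = 1]])
          (sup [set dist_to w V | w in [set w | W w /\ enorm w = 1]]).

Definition stratification (p : nat) (X : set E) (I : Type) (S : I -> set E) :
    Prop :=
  [/\ partition setT S X,
      forall x, X x -> exists2 U, nbhs x U &
        finite_set [set i | S i `&` U !=set0],
      forall i, submanifold p (S i) &
      forall i j, i <> j -> closure (S i) `&` S j !=set0 ->
        S j `<=` closure (S i) `\` S i].

Definition whitney_a (I : Type) (S : I -> set E) : Prop :=
  forall i j, i <> j -> forall x, (closure (S i) `&` S j) x ->
  forall (u : nat -> E) (T : {vspace E}),
    (forall k, S i (u k)) -> u @ \oo --> x ->
    (fun k => gap (tangent (S i) (u k)) [set` T]) @ \oo --> (0 : R) ->
    tangent (S j) x `<=` [set` T].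

Definition whitney_stratification (p : nat) (X : set E) (I : Type)
    (S : I -> set E) : Prop :=
  stratification p X S /\ whitney_a S.

End Stratifications.

Section RiemannianGradient.
Variables (R : realType) (n : nat).
Implicit Types (f : 'rV[R]_n -> \bar R) (M : set 'rV[R]_(n + 1)).

(* Here M is a stratum of graph f containing graph_pt f x.  Its projection
   Pi @` M carries the manifold structure transported by Pi, so that its C^1
   curves through x are the Pi \o g with g a C^1 curve of M through
   graph_pt f x. *)
Definition proj_tangent f M (x : 'rV[R]_n) : set 'rV[R]_n :=
  Pi (n:=n) @` tangent M (graph_pt f x).

(* The graph of v |-> d(f|_{Pi M})(x)(v): the derivative at 0 of f along a
   C^1 curve of Pi @` M with velocity v at x.  Along such a curve f is finite. *)
Definition stratum_differential f M (x v : 'rV[R]_n) (c : R) : Prop :=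
  exists2 g, C1_curve M (graph_pt f x) g &
    v = Pi (derive1 g 0) /\
    c = derive1 (fun t : R => fine (f (Pi (g t)))) 0.

Definition is_riemannian_gradient f M (x g : 'rV[R]_n) : Prop :=
  proj_tangent f M x g /\
  forall v, proj_tangent f M x v ->
  forall c, stratum_differential f M x v c -> dotp g v = c.

Lemma riemannian_gradient_unique f M (x g h : 'rV[R]_n) :
  is_riemannian_gradient f M x g -> is_riemannian_gradient f M x h -> g = h.
Proof.
move=> [Tg Hg] [Th Hh].
have eqT v : proj_tangent f M x v -> dotp g v = dotp h v.
  move=> Tv; case: (Tv) => _ [k kM <-] vE.
  have D : stratum_differential f M x v
      (derive1 (fun t : R => fine (f (Pi (k t)))) 0) by exists k.
  by rewrite (Hg _ Tv _ D) (Hh _ Tv _ D).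
have : \sum_(i < n) (g 0 i - h 0 i) ^+ 2 = 0.
  have -> : \sum_(i < n) (g 0 i - h 0 i) ^+ 2 =
      (dotp g g - dotp h g) - (dotp g h - dotp h h).
    rewrite /dotp -!sumrB; apply: eq_bigr => i _.
    by rewrite -!mulrBl -mulrBr -expr2.
  by rewrite !eqT // !subrr.
move/eqP; rewrite psumr_eq0 => [/allP gh|i _]; last exact: sqr_ge0.
apply/rowP => i; apply/eqP; rewrite -subr_eq0 -sqrf_eq0.
by have := gh i; rewrite mem_index_enum => /(_ isT).
Qed.

(* Total version: the value 0 is only a default for when no gradient exists,
   which does not happen at points of a C^1 submanifold M contained in graph f
   without vertical tangent vectors. *)
Definition riemannian_gradient f M (x : 'rV[R]_n) : 'rV[R]_n :=
  xget 0 [set g | is_riemannian_gradient f M x g].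

End RiemannianGradient.

(* Main.v *)
Require Import Defs.
From HB Require Import structures.
From mathcomp Require Import all_boot all_order all_algebra.
From mathcomp Require Import all_classical all_reals all_analysis.
From mathcomp Require Import ring lra.
Set Implicit Arguments.
Unset Strict Implicit.
Unset Printing Implicit Defensive.
Import Order.TTheory GRing.Theory Num.Theory.
Import numFieldNormedType.Exports.
Local Open Scope classical_set_scope.
Local Open Scope ring_scope.

(** The proof has two halves, joined by one statement about normals: if x* is a
Clarke subgradient of f at x, then the vector (x*, -1) of R^(n+1) is orthogonal
to the tangent space at (x, f x) of the stratum S_x through that point
([clarke_normal]).

Why (x*, -1) is normal.  A Frechet subgradient p bounds the decrease of
f - <p, .> near x by o(|y - x|).  Along a C^1 curve of S_x the function f is just
the last coordinate, and the bound applies in both directions of the curve, so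
the derivative of f - <p, .> along it is zero ([frechet_normal]).  Normality
passes to limits ([normal_limit]): infinitely many points of a convergent sequence
of the graph lie in one stratum S_i, since the stratification is locally finite;
if the limit point is in S_i the tangent spaces converge to the one at the limit,
and otherwise a subsequence of them converges in the gap and property (a) puts the
tangent space of the stratum of the limit inside the limit space.  Thus (p, -1) is
normal for p in the limiting subdifferential, (q, 0) is normal for q in the
asymptotic one, hence (p + q, -1) is normal, and this is a closed convex condition
on p + q.

Part (i).  The condition says that x* and the Riemannian gradient have the same
scalar product with every vector of T_x X_x.  As the gradient belongs to that
space, the Cauchy-Schwarz inequality gives the bound.

Part (ii).  If 0 is a Clarke subgradient at x, then every tangent vector of S_x at
(x, f x) has last coordinate zero: the point is critical for the restriction to
S_x of the last coordinate, and the critical value of f is a critical value of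
that restriction.  Charts and a Lindelof argument reduce the claim to a C^p
function on an open set of R^d.  Here d <= n, because a stratum of dimension n + 1
would have vertical tangent vectors; so p >= d, and the theorem of A. P. Morse
applies ([sard]).

The proof of [sard] must use the exact hypothesis p >= d, so it cannot restrict
the function to the zero sets of its higher derivatives, where it would be less
regular.  Instead, [morse_lemma] treats all functions at once: every subset A of
R^d is a countable union of pieces psi(Z), with Z in some R^m and m <= d, such that
each C^k function vanishing on A is o(|x - y|^k) at psi(x), uniformly in y in Z.
For the critical set A and k = p - 1 this applies to the partial derivatives of
the function, whose increments on a piece are then o(|x - y|^p) by the mean value
theorem, and a grid of small cubes shows that the image of a piece is negligible. *)

(** * Sigma-ideals of subsets of R^m *)

Section Lindelof.
Variables (R : realType) (m : nat).

Lemma rat_approx (x : 'rV[R]_m) (e : R) : 0 < e ->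
  exists q : 'rV[rat]_m, ball (map_mx ratr q : 'rV[R]_m) e x.
Proof.
move=> e0.
have H i : exists q : rat, `|ratr q - x 0 i| < e.
  have [|q] := @rat_in_itvoo R (x 0 i - e) (x 0 i + e).
    by rewrite ltrD2l (lt_trans _ e0)// oppr_lt0.
  rewrite in_itv/= => /andP[q1 q2]; exists q.
  by rewrite ltr_norml; apply/andP; split; lra.
exists (\row_i sval (cid (H i))); split => // i j.
by rewrite ord1 !mxE /ball/=; exact: svalP (cid (H j)).
Qed.

(** The balls with rational centre and radius 1/(k+1) form a countable
family, and every point of C lies in one of them that is contained in a
neighbourhood witnessing the local property.  Applied below to countable unions
of flat pieces and to sets with negligible image. *)
Lemma lindelof_ideal (Q : set 'rV[R]_m -> Prop) (C : set 'rV[R]_m) :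
  Q set0 ->
  (forall F : nat -> set 'rV[R]_m, (forall i, Q (F i)) -> Q (\bigcup_i F i)) ->
  (forall A B, A `<=` B -> Q B -> Q A) ->
  (forall x, C x -> exists2 N, nbhs x N & Q (C `&` N)) -> Q C.
Proof.
move=> Q0 QU QS loc.
pose B (k : 'rV[rat]_m * nat) : set 'rV[R]_m :=
  C `&` ball (map_mx ratr k.1 : 'rV[R]_m) (k.2.+1%:R^-1).
pose F i := if unpickle i is Some k then if `[< Q (B k) >] then B k else set0
            else set0.
apply: (QS _ (\bigcup_i F i)); last first.
  apply: QU => i; rewrite /F; case: unpickle => [k|//].
  by case: ifPn => // /asboolP.
move=> x Cx; have [N /nbhs_ballP[e e0 eN] QN] := loc _ Cx.
have [k ke] : exists k : nat, k.+1%:R^-1 < e / 2.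
  exists (Num.trunc (e / 2)^-1).
  have e2 : 0 < e / 2 by exact: divr_gt0.
  rewrite invf_plt ?posrE ?ltr0n//.
  exact: truncnS_gt.
have [q xq] := @rat_approx x k.+1%:R^-1 ltac:(by rewrite invr_gt0 ltr0n).
have QB : Q (B (q, k)).
  apply: QS QN => y [Cy /= qy]; split => //; apply: eN.
  exact: ball_splitr (le_ball (ltW ke) xq) (le_ball (ltW ke) qy).
exists (pickle (q, k)) => //; rewrite /F pickleK asboolT//.
Qed.

End Lindelof.

(** * Derivatives and functions of class C^k *)

Section CkTheory.
Variables (R : realType).
Implicit Types V W : normedModType R.

(** The epsilon form of differentiability: it is how a
differential is produced when it is known only through an estimate. *)
Lemma differentiable_expansion V W (f : V -> W) (x : V) (L : {linear V -> W}) :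
  continuous L ->
  (forall e : R, 0 < e -> \forall y \near x,
    `|f y - f x - L (y - x)| <= e * `|y - x|) ->
  differentiable f x /\ 'd f x = L :> (V -> W).
Proof.
move=> cL H.
have E : f \o shift x = cst (f x) + L +o_ 0 id.
  apply/eqaddoP => e e0; have := H e e0.
  rewrite [X in _ -> X](near_shift x) => Hx.
  apply: filterS Hx => y /=.
  by rewrite /= sub0r !fctE /= subrK opprD addrA.
have d := diff_unique cL E.
by split => //; apply/diff_locallyP; rewrite d; split.
Qed.

Lemma expansion_differentiable V W (f : V -> W) (x : V) :
  differentiable f x -> forall e : R, 0 < e -> \forall y \near x,
    `|f y - f x - 'd f x (y - x)| <= e * `|y - x|.
Proof.
move=> /diff_locallyP[_ /eqaddoP H] e e0; have := H e e0.
rewrite [X in X -> _](near_shift x) => Hx.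
apply: filterS Hx => y /=.
by rewrite /= sub0r !fctE /= subrK opprD addrA.
Qed.

(** The differential of f serves for g, since both expansions
only see a neighbourhood of x. *)
Lemma near_eq_differentiable V W (f g : V -> W) x :
  {near x, f =1 g} -> differentiable f x -> differentiable g x.
Proof.
move=> fg df.
have cd : continuous ('d f x) by exact: diff_continuous.
suff /(differentiable_expansion cd)[] : forall e : R, 0 < e -> \forall y \near x,
    `|g y - g x - 'd f x (y - x)| <= e * `|y - x| by [].
move=> e e0; have := expansion_differentiable df e0.
by rewrite -(nbhs_singleton fg); apply: filterS2 fg => y <-.
Qed.

(** Class C^k is local: the directional derivatives of f and g agree on U because
U is open, so the induction can proceed with them. *)
Lemma Ck_on_ext V W k (U : set V) (f g : V -> W) : open U ->
  (forall x, U x -> f x = g x) -> Ck_on k U f -> Ck_on k U g.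
Proof.
move=> oU; elim: k f g => [|k IH] f g fg /=.
  move=> Cf x Ux; have nfg : \forall y \near x, f y = g y.
    by apply: filterS (open_nbhs_nbhs (conj oU Ux)).
  rewrite /prop_for /continuous_at -(fg x Ux); apply: cvg_trans (Cf x Ux).
  exact: near_eq_cvg.
have nfg x : U x -> \forall y \near x, f y = g y.
  by move=> Ux; apply: filterS (open_nbhs_nbhs (conj oU Ux)).
move=> [df Df]; split => [x Ux|v].
  exact: near_eq_differentiable (nfg x Ux) (df x Ux).
by apply: IH (Df v) => x Ux; apply: near_eq_derive; exact: nfg.
Qed.

Lemma Ck_on_sub V W k (U U' : set V) (f : V -> W) :
  U' `<=` U -> Ck_on k U f -> Ck_on k U' f.
Proof.
move=> UU; elim: k f => [|k IH] f /=; first by move=> Cf x /UU; exact: Cf.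
by move=> [df Df]; split => [x /UU/df//|v]; exact: IH.
Qed.

Lemma Ck_onS V W k (U : set V) (f : V -> W) : Ck_on k.+1 U f -> Ck_on k U f.
Proof.
elim: k f => [|k IH] f [df Df].
  by move=> x Ux; apply: differentiable_continuous; exact: df.
by split => // v; apply: IH; exact: Df.
Qed.

Lemma Ck_on_le V W k l (U : set V) (f : V -> W) :
  (k <= l)%N -> Ck_on l U f -> Ck_on k U f.
Proof.
move=> kl; rewrite -(subnK kl); elim: (l - k)%N => // j IH.
by rewrite addSn => /Ck_onS.
Qed.

Lemma Ck_on_cst V W k (U : set V) (a : W) : Ck_on k U (cst a : V -> W).
Proof.
elim: k a => [|k IH] a /=; first by move=> x _; exact: cvg_cst.
split => [x _|v]; first exact: differentiable_cst.
have -> : (fun x : V => 'D_v (cst a) x) = cst 0.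
  by apply/funext => x; rewrite derive_cst.
exact: IH.
Qed.

Lemma Ck_onD V W k (U : set V) (f g : V -> W) : open U ->
  Ck_on k U f -> Ck_on k U g -> Ck_on k U (fun x => f x + g x).
Proof.
move=> oU; elim: k f g => [|k IH] f g /=.
  by move=> Cf Cg x Ux; exact: cvgD (Cf x Ux) (Cg x Ux).
move=> [df Df] [dg Dg]; split=> [x Ux|v].
  exact: (differentiableD (df x Ux) (dg x Ux)).
apply: Ck_on_ext (IH _ _ (Df v) (Dg v)) => // x Ux.
by rewrite (@deriveD _ _ _ f g)//; apply: diff_derivable; [exact: df|exact: dg].
Qed.

Lemma Ck_onM V k (U : set V) (f g : V -> R) : open U ->
  Ck_on k U f -> Ck_on k U g -> Ck_on k U (fun x => f x * g x).
Proof.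
move=> oU; elim: k f g => [|k IH] f g.
  by move=> Cf Cg x Ux; exact: cvgM (Cf x Ux) (Cg x Ux).
move=> Cf Cg; have [df Df] := Cf; have [dg Dg] := Cg; split=> [x Ux|v].
  exact: (differentiableM (df x Ux) (dg x Ux)).
have C := Ck_onD oU (IH _ _ (Ck_onS Cf) (Dg v)) (IH _ _ (Ck_onS Cg) (Df v)).
apply: Ck_on_ext C => // x Ux.
by rewrite (@deriveM _ _ f g)//; apply: diff_derivable; [exact: df|exact: dg].
Qed.

Lemma Ck_onV V k (U : set V) (f : V -> R) : open U ->
  (forall x, U x -> f x != 0) ->
  Ck_on k U f -> Ck_on k U (fun x => (f x)^-1).
Proof.
move=> oU f0; elim: k => [|k IH].
  by move=> Cf x Ux; apply: cvgV (f0 x Ux) (Cf x Ux).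
move=> Cf; have [df Df] := Cf; split=> [x Ux|v].
  exact: (differentiableV (df x Ux) (f0 x Ux)).
have Ci := IH (Ck_onS Cf).
have C := Ck_onM oU (Ck_onM oU (@Ck_on_cst _ _ k U (-1 : R)) (Df v)) (Ck_onM oU Ci Ci).
apply: Ck_on_ext C => // x Ux.
rewrite (@deriveV _ _ f) ?f0//; last exact/diff_derivable/df.
by rewrite /= mulN1r -invfM -expr2 mulNr scaleNr mulrC.
Qed.

(** By the very definition of directional derivatives, that of f \o L in the
direction v is that of f in the direction L v, composed with L. *)
Lemma Ck_on_lin_pre V V' W k (U : set V) (f : V -> W) (L : {linear V' -> V}) :
  continuous L ->
  Ck_on k U f -> Ck_on k (L @^-1` U) (f \o L).
Proof.
move=> cL; elim: k f => [|k IH] f /=.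
  by move=> Cf x Ux; apply: continuous_comp; [exact: cL|exact: Cf].
move=> [df Df]; split=> [x Ux|v].
  by apply: differentiable_comp; [exact: linear_differentiable|exact: df].
have C := IH _ (Df (L v)).
suff -> : (fun x => 'D_v (f \o L) x) = (fun x => 'D_(L v) f x) \o L by [].
apply/funext => x; rewrite /derive/=.
suff -> : (fun h => h^-1 *: (f (L (h *: v + x)) - f (L x))) =
          (fun h => h^-1 *: (f (h *: L v + L x) - f (L x))) by [].
by apply/funext => h /=; rewrite linearP.
Qed.

Lemma Ck_on_lin_post V W W' k (U : set V) (f : V -> W) (L : {linear W -> W'}) :
  open U -> continuous L ->
  Ck_on k U f -> Ck_on k U (L \o f).
Proof.
move=> oU cL; elim: k f => [|k IH] f /=.
  by move=> Cf x Ux; apply: continuous_comp; [exact: Cf|exact: cL].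
move=> [df Df]; split=> [x Ux|v].
  by apply: differentiable_comp; [exact: df|exact: linear_differentiable].
apply: Ck_on_ext (IH _ (Df v)) => // x Ux.
have dL := linear_differentiable (f x) cL.
rewrite /= (deriveE _ (df x Ux)) (deriveE _ (differentiable_comp (df x Ux) dL)).
by rewrite (diff_comp (df x Ux) dL) /= diff_lin.
Qed.

Lemma continuous_scalel_at (T : topologicalType) V (s : T -> R) (v : V) x :
  {for x, continuous s} -> {for x, continuous (fun z => s z *: v)}.
Proof. by move=> cs; apply: cvgZr_tmp. Qed.

Lemma continuous_add_at (T : topologicalType) V (f g : T -> V) x :
  {for x, continuous f} -> {for x, continuous g} ->
  {for x, continuous (fun z => f z + g z)}.
Proof. by move=> cf cg; apply: cvgD. Qed.

Lemma derive_linear V W (L : {linear V -> W}) (x v : V) :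
  continuous L -> 'D_v L x = L v.
Proof.
by move=> cL; rewrite (deriveE _ (linear_differentiable x cL)) diff_lin.
Qed.

Lemma deriveZl V W (k : V -> R) (w : W) (x v : V) : differentiable k x ->
  'D_v (fun z => k z *: w) x = 'D_v k x *: w.
Proof.
by move=> dk; rewrite (deriveE _ (differentiableZl w dk)) (diffZl _ dk) deriveE.
Qed.

Lemma derive_comp V W W' (f : V -> W) (g : W -> W') (x v : V) :
  differentiable f x -> differentiable g (f x) ->
  'D_v (g \o f) x = 'D_('D_v f x) g (f x).
Proof.
move=> df dg; rewrite (deriveE _ (differentiable_comp df dg)) (diff_comp df dg).
by rewrite (deriveE _ df) (deriveE _ dg).
Qed.

Lemma derive_dirD V W (f : V -> W) (x u v : V) : differentiable f x ->
  'D_(u + v) f x = 'D_u f x + 'D_v f x.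
Proof. by move=> df; rewrite !(deriveE _ df) linearD. Qed.

Lemma derive_dirZ V W (f : V -> W) (x v : V) (a : R) : differentiable f x ->
  'D_(a *: v) f x = a *: 'D_v f x.
Proof. by move=> df; rewrite !(deriveE _ df) linearZZ. Qed.

Lemma derive_dirP V W (f : V -> W) (x : V) (a : R) (u v : V) : differentiable f x ->
  'D_(a *: u + v) f x = a *: 'D_u f x + 'D_v f x.
Proof. by move=> df; rewrite derive_dirD// derive_dirZ. Qed.

Lemma derive_expansion V W (f : V -> W) (x : V) :
  differentiable f x -> forall e : R, 0 < e -> \forall y \near x,
    `|f y - f x - 'D_(y - x) f x| <= e * `|y - x|.
Proof.
move=> df e e0; have := expansion_differentiable df e0.
by apply: filterS => y; rewrite (deriveE _ df).
Qed.

Lemma differentiable_derive V W (f : V -> W) (x : V) (L : {linear V -> W}) :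
  continuous L ->
  (forall e : R, 0 < e -> \forall y \near x,
    `|f y - f x - L (y - x)| <= e * `|y - x|) ->
  differentiable f x /\ forall v, 'D_v f x = L v.
Proof.
move=> cL /(differentiable_expansion cL)[df Df]; split => // v.
by rewrite (deriveE _ df) Df.
Qed.

End CkTheory.

(** * Coordinates and graphs over a coordinate hyperplane *)

Section RowNorm.
Variables (R : realType).

Lemma rV_norm_le n (x : 'rV[R]_n) (e : R) : 0 <= e ->
  (forall i, `|x 0 i| <= e) -> `|x| <= e.
Proof.
move=> e0 H; rewrite [leLHS]/Num.Def.normr/= mx_normrE.
by rewrite (bigmax_le _ e0)// => -[i j] _; rewrite ord1.
Qed.

Lemma rV_coord_le n (x : 'rV[R]_n) i : `|x 0 i| <= `|x|.
Proof.
rewrite [leRHS]/Num.Def.normr/= mx_normrE.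
exact: (le_bigmax _ (fun ij : 'I_1 * 'I_n => `|x ij.1 ij.2|) (0, i)).
Qed.

Lemma ballE (V : normedModType R) (x y : V) e : ball x e y <-> `|y - x| < e.
Proof. by rewrite -ball_normE /ball_/= distrC. Qed.

(** A linear map on row vectors is a finite sum of coordinates times constant
vectors. *)
Lemma rV_linear_continuous n (W : normedModType R) (L : {linear 'rV[R]_n -> W}) :
  continuous L.
Proof.
have -> : (L : _ -> _) = fun x => \sum_(i < n) x 0 i *: L (delta_mx 0 i).
  apply/funext => x; rewrite [in LHS](row_sum_delta x) linear_sum.
  by apply: eq_bigr => i _; rewrite linearZ.
apply: continuous_big => [|i _ x]; first exact: add_continuous.
by apply: continuous_scalel_at; exact: coord_continuous.
Qed.

End RowNorm.

Section Insert.
Variables (R : realType) (n : nat) (j : 'I_n.+1).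

(** The inverse of (col' j, coordinate j): R^n.+1 is seen as R^n x R with the
R factor in position j, so that a hypersurface solved for the coordinate j is the
range of y |-> insert y (h y). *)
Definition insert (y : 'rV[R]_n) (t : R) : 'rV[R]_n.+1 :=
  \row_i (if unlift j i is Some i' then y 0 i' else t).

Definition insert0 (y : 'rV[R]_n) : 'rV[R]_n.+1 := insert y 0.

Definition axis : 'rV[R]_n.+1 := delta_mx 0 j.

Lemma insert_col' x : insert (col' j x) (x 0 j) = x.
Proof.
by apply/rowP => i; rewrite mxE; case: unliftP => [i' ->|-> //]; rewrite mxE.
Qed.

Lemma insertE y t : insert y t = insert0 y + t *: axis.
Proof.
apply/rowP => i; rewrite !mxE eqxx/=; case: unliftP => [i' ->|->].
  by rewrite eq_sym (negbTE (neq_lift _ _)) mulr0 addr0.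
by rewrite eqxx mulr1 add0r.
Qed.

Lemma insertB y t y' t' : insert y t - insert y' t' = insert (y - y') (t - t').
Proof.
by apply/rowP => i; rewrite !mxE; case: unliftP => [i' _|_]; rewrite ?mxE.
Qed.

Lemma norm_insert y t : `|insert y t| <= `|y| + `|t|.
Proof.
apply: rV_norm_le => [|i]; first by rewrite addr_ge0.
rewrite mxE; case: unliftP => [i' _|_]; last by rewrite lerDr.
by rewrite (le_trans (rV_coord_le _ _))// lerDl.
Qed.

Lemma norm_col' (x : 'rV[R]_n.+1) : `|col' j x| <= `|x|.
Proof. by apply: rV_norm_le => // i; rewrite mxE rV_coord_le. Qed.

Lemma norm_insert_lt y t e : `|y| < e -> `|t| < e -> `|insert y t| < e.
Proof.
move=> ye te; have e0 : 0 < e by rewrite (le_lt_trans _ te).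
have : `|insert y t| <= Num.max `|y| `|t|.
  apply: rV_norm_le => [|i]; first by rewrite le_max normr_ge0.
  rewrite mxE le_max; case: unliftP => [i' _|_]; last by rewrite lexx orbT.
  by rewrite rV_coord_le.
by move=> /le_lt_trans; apply; rewrite gt_max ye.
Qed.

Lemma insert0_is_linear : linear insert0.
Proof.
move=> a u v; apply/rowP => i; rewrite !mxE; case: unliftP => [i' _|_].
  by rewrite !mxE.
by rewrite mulr0 addr0.
Qed.
HB.instance Definition _ := GRing.isLinear.Build R _ _ _ insert0 insert0_is_linear.

Lemma insert0_continuous : continuous insert0.
Proof.
exact: rV_linear_continuous. Qed.

End Insert.

Section ImplicitFunction.
Variables (R : realType) (n : nat) (j : 'I_n.+1).
Local Notation e_j := (axis R j).

Lemma graph_map_cvg (h : 'rV[R]_n -> R) y : {for y, continuous h} ->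
  {for y, continuous (fun y => insert j y (h y))}.
Proof.
move=> ch; rewrite (_ : (fun y => insert j y (h y)) =
  (fun y => insert0 j y + h y *: e_j)); last by apply/funext => z; rewrite insertE.
apply: continuous_add_at; first exact: insert0_continuous.
exact: continuous_scalel_at.
Qed.

Lemma graph_map_diff (h : 'rV[R]_n -> R) y : differentiable h y ->
  differentiable (fun y => insert j y (h y)) y /\
  forall v, 'D_v (fun y => insert j y (h y)) y = insert j v ('D_v h y).
Proof.
move=> dh; rewrite (_ : (fun y => insert j y (h y)) =
  (fun y => insert0 j y + h y *: e_j)); last by apply/funext => z; rewrite insertE.
have d0 : differentiable (insert0 j) y.
  exact: linear_differentiable y (@insert0_continuous R n j).
have d1 : differentiable (fun z => h z *: e_j) y by exact: differentiableZl.
have d01 : differentiable (fun y => insert0 j y + h y *: e_j) y.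
  exact: differentiableD.
split=> // v.
rewrite (@deriveD _ _ _ (insert0 j) (fun z => h z *: e_j)); last 2 first.
- exact: diff_derivable.
- exact: diff_derivable.
rewrite (derive_linear _ _ (@insert0_continuous R n j)) deriveZl//.
by rewrite insertE.
Qed.

(** Chain rule along a graph.  Only two directional derivatives of f occur, one
horizontal and one along the axis j, and both have the form of the left-hand side:
this closes the induction of [Ck_on_graph]. *)
Lemma graph_comp_deriv (f : 'rV[R]_n.+1 -> R) (h : 'rV[R]_n -> R) y :
  differentiable h y -> differentiable f (insert j y (h y)) ->
  differentiable (fun y => f (insert j y (h y))) y /\
  forall v, 'D_v (fun y => f (insert j y (h y))) y =
    'D_(insert0 j v) f (insert j y (h y)) +
    'D_v h y * 'D_e_j f (insert j y (h y)).
Proof.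
move=> dh df; have [dg Dg] := graph_map_diff dh.
have dfg : differentiable (f \o (fun y => insert j y (h y))) y.
  exact: differentiable_comp.
split => // v.
rewrite (derive_comp _ dg df) Dg [in LHS](insertE j v).
by rewrite (derive_dirD _ _ df) (derive_dirZ _ _ df).
Qed.

(** By [graph_comp_deriv] the derivatives of the composition are sums and products of
derivatives of h and of functions of the same form, of class C^(k-1). *)
Lemma Ck_on_graph k (U : set 'rV[R]_n.+1) (V : set 'rV[R]_n)
    (f : 'rV[R]_n.+1 -> R) (h : 'rV[R]_n -> R) :
  open V -> (forall y, V y -> U (insert j y (h y))) ->
  Ck_on k U f -> Ck_on k V h -> Ck_on k V (fun y => f (insert j y (h y))).
Proof.
move=> oV VU; elim: k f => [|k IH] f.
  move=> Cf Ch y Vy; apply: continuous_comp; last exact/Cf/VU.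
  exact: graph_map_cvg (Ch y Vy).
move=> [df Df] Ch; have [dh Dh] := Ch; split => [y Vy|v].
  exact: (graph_comp_deriv (dh y Vy) (df _ (VU y Vy))).1.
have C := Ck_onD oV (IH _ (Df (insert0 j v)) (Ck_onS Ch))
  (Ck_onM oV (Dh v) (IH _ (Df e_j) (Ck_onS Ch))).
apply: Ck_on_ext C => // y Vy.
by rewrite (graph_comp_deriv (dh y Vy) (df _ (VU y Vy))).2.
Qed.

(** Write D for the increment of h and v for that of the variable.  As g is constant
along the graph, its expansion gives |a D + 'D_(v, 0) g| <= c |a| (|v| + |D|) with
a the derivative along the axis.  For c <= 1/2 this first bounds |D| by a multiple
of |v|, and then bounds the error by an arbitrarily small multiple of |v|. *)
Lemma implicit_diff (g : 'rV[R]_n.+1 -> R) (h : 'rV[R]_n -> R) y :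
  {for y, continuous h} -> (\forall z \near y, g (insert j z (h z)) = 0) ->
  differentiable g (insert j y (h y)) -> 'D_e_j g (insert j y (h y)) != 0 ->
  differentiable h y /\ forall v, 'D_v h y =
    - ('D_e_j g (insert j y (h y)))^-1 * 'D_(insert0 j v) g (insert j y (h y)).
Proof.
move=> ch g0 dg; set x := insert j y (h y); set a := 'D_e_j g x => a0.
pose L0 v := (- a^-1) * 'D_(insert0 j v) g x.
have L0lin : linear L0.
  by move=> c u v; rewrite /L0 linearP (derive_dirP _ _ _ dg)/= mulrDr mulrCA.
pose HL := GRing.isLinear.Build R _ _ _ L0 L0lin.
pose L : {linear 'rV[R]_n -> R} := HB.pack L0 HL.
have cL : continuous L.
  exact: rV_linear_continuous.
have [K K0 LK] := linear_lipschitz cL.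
suff /(differentiable_derive cL)[dh Dh] : forall e : R, 0 < e ->
    \forall z \near y, `|h z - h y - L (z - y)| <= e * `|z - y|.
  by split => // v; rewrite Dh.
move=> e e0.
have na0 : 0 < `|a| by rewrite normr_gt0.
pose c := Num.min (2^-1) (e / (2 * K + 2)).
have K2 : 0 < 2 * K + 2 by lra.
have c0 : 0 < c by rewrite lt_min invr_gt0 ltr0n divr_gt0.
have c2 : c <= 2^-1 by rewrite ge_min lexx.
have ce : c * (2 * K + 2) <= e.
  by rewrite -ler_pdivlMr// ge_min lexx orbT.
have gx0 : g x = 0 by exact: nbhs_singleton g0.
have := derive_expansion dg (mulr_gt0 na0 c0).
rewrite -/x => H; have {}H := graph_map_cvg ch H.
near=> z.
have gz : g (insert j z (h z)) = 0 by near: z.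
have : `|g (insert j z (h z)) - g x - 'D_(insert j z (h z) - x) g x| <=
    `|a| * c * `|insert j z (h z) - x| by near: z.
rewrite gz gx0 subrr sub0r normrN [in X in X -> _]/x insertB [insert j (z - y) _]insertE.
rewrite -/x (derive_dirD _ _ dg) (derive_dirZ _ _ dg) -/a => H1.
set D := h z - h y in H1 *; set v := z - y in H1 *.
have E : D *: a + 'D_(insert0 j v) g x = a * (D - L v).
  rewrite /L/= /L0 mulrBr mulNr mulrN opprK mulrA divff// mul1r.
  by rewrite [in LHS]/GRing.scale/= mulrC.
have : `|a| * `|D - L v| <= `|a| * (c * (`|v| + `|D|)).
  rewrite -normrM -E addrC (le_trans H1)// -mulrA ler_pM2l// ler_pM2l//.
  by rewrite -insertE norm_insert.
rewrite ler_pM2l// => H2.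
have D1 : `|D| <= `|D - L v| + `|L v|.
  by rewrite -[in leLHS](subrK (L v) D) ler_normD.
have D2 := LK v.
have v0 : 0 <= `|v| by [].
have n0 : 0 <= `|D| by [].
have D3 : `|D| <= (2 * K + 1) * `|v|.
  have : c * (`|v| + `|D|) <= 2^-1 * (`|v| + `|D|).
    by rewrite ler_wpM2r// addr_ge0.
  by lra.
apply: (le_trans H2); apply: (@le_trans _ _ (c * ((2 * K + 2) * `|v|))).
  by rewrite ler_pM2l//; lra.
by rewrite mulrA ler_wpM2r.
Unshelve. all: by end_near. Qed.

End ImplicitFunction.

(** * The implicit function theorem for one equation *)

Lemma continuous_at_gt (R : realType) (T : topologicalType) (f : T -> R) x a :
  {for x, continuous f} -> a < f x -> nbhs x [set y | a < f y].
Proof. by move=> cf fa; exact: (cf _ (lt_nbhsr fa)). Qed.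

Lemma continuous_at_lt (R : realType) (T : topologicalType) (f : T -> R) x a :
  {for x, continuous f} -> f x < a -> nbhs x [set y | f y < a].
Proof. by move=> cf fa; exact: (cf _ (lt_nbhsl fa)). Qed.

Lemma continuous_at_distP (R : realType) (T : topologicalType)
    (V : normedModType R) (f : T -> V) x :
  {for x, continuous f} <->
  forall e : R, 0 < e -> \forall z \near x, `|f x - f z| < e.
Proof. by split=> [/cvgrPdist_lt//|H]; apply/cvgrPdist_lt. Qed.

Lemma nbhs_ballI (R : realType) (V : normedModType R) (x : V) (A B : set V) :
  nbhs x A -> nbhs x B ->
  exists2 e : R, 0 < e & forall y, ball x e y -> A y /\ B y.
Proof.
move=> nA nB; have /nbhs_ballP[e e0 He] : nbhs x (A `&` B) by exact: filterI.
by exists e => // y /He.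
Qed.

Section Lines.
Variables (R : realType) (V : normedModType R).

Lemma line_is_derive (f : V -> R) (x v : V) (t : R) :
  differentiable f (x + t *: v) ->
  is_derive t 1 (fun t : R => f (x + t *: v)) ('D_v f (x + t *: v)).
Proof.
move=> df.
have dl : differentiable (fun s : R => s *: v) t.
  by apply: differentiableZl.
have da : differentiable (fun s : R => x + s *: v) t.
  by apply: differentiableD.
have dfa : differentiable (f \o (fun s : R => x + s *: v)) t.
  exact: differentiable_comp.
apply: DeriveDef; first exact: diff_derivable.
rewrite (derive_comp _ da df); congr ('D__ f _).
rewrite (@deriveD _ _ _ (cst x) (fun s : R => s *: v))//; last exact: diff_derivable.
by rewrite derive_cst add0r deriveZl// derive_id scale1r.
Qed.

Lemma line_increasing (f : V -> R) (x v : V) (a b : R) : a < b ->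
  (forall t, a <= t <= b -> differentiable f (x + t *: v)) ->
  (forall t, a <= t <= b -> 0 < 'D_v f (x + t *: v)) ->
  f (x + a *: v) < f (x + b *: v).
Proof.
move=> ab df Df; rewrite -subr_gt0.
have [||c] := @MVT R (fun t => f (x + t *: v)) (fun t => 'D_v f (x + t *: v)) a b ab.
- move=> t; rewrite in_itv/= => /andP[at_ tb]; apply/line_is_derive/df.
  by rewrite !ltW.
- apply: derivable_within_continuous => t tab; apply: ex_derive.
  by apply/line_is_derive/df; move: tab; rewrite in_itv.
- rewrite in_itv/= => /andP[ac cb] ->; rewrite mulr_gt0 ?subr_gt0//.
  by apply: Df; rewrite !ltW.
Qed.

Lemma line_zero (f : V -> R) (x v : V) (a b : R) : a <= b ->
  (forall t, a <= t <= b -> differentiable f (x + t *: v)) ->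
  f (x + a *: v) <= 0 -> 0 <= f (x + b *: v) ->
  exists2 t, a <= t <= b & f (x + t *: v) = 0.
Proof.
move=> ab df fa fb.
have [||c] := @IVT R (fun t => f (x + t *: v)) a b 0 ab.
- apply: derivable_within_continuous => t tab; apply: ex_derive.
  by apply/line_is_derive/df; move: tab; rewrite in_itv.
- by rewrite ge_min fa le_max fb orbT.
- by rewrite in_itv/= => cab fc; exists c.
Qed.

End Lines.

Section ImplicitExists.
Variables (R : realType) (n : nat) (j : 'I_n.+1).
Local Notation e_j := (axis R j).

(** On a small box g is strictly increasing along the axis j, negative on the lower
face and positive on the upper one, so that the intermediate value theorem gives
a unique zero h y on each vertical segment.  The same two sign conditions, taken
at h y - d and h y + d, give the continuity of h; [implicit_diff] gives its
derivatives, and their formula raises the regularity of h step by step up to that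
of g. *)
Lemma implicit_function_pos k (U : set 'rV[R]_n.+1) (g : 'rV[R]_n.+1 -> R) x0 :
  open U -> U x0 -> Ck_on k.+1 U g -> g x0 = 0 -> 0 < 'D_e_j g x0 ->
  exists r (h : 'rV[R]_n -> R),
    [/\ 0 < r, Ck_on k.+1 (ball (col' j x0) r) h,
      forall y, ball (col' j x0) r y -> U (insert j y (h y)) &
      forall x, ball x0 r x -> g x = 0 -> h (col' j x) = x 0 j].
Proof.
move=> oU Ux0 Cg g0 D0; have [dg Dg] := Cg.
set y0 := col' j x0; set t0 := x0 0 j.
have cD : {for x0, continuous (fun x => 'D_e_j g x)}.
  have : Ck_on 0 U ('D_e_j g) by apply: Ck_on_le (Dg e_j).
  exact.
have [rho rho0 Hrho] : exists2 rho, 0 < rho &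
    forall x, ball x0 rho x -> U x /\ 0 < 'D_e_j g x.
  have n1 := open_nbhs_nbhs (conj oU Ux0).
  have n2 : nbhs x0 [set x | 0 < 'D_e_j g x].
    exact: continuous_at_gt cD D0.
  exact: nbhs_ballI n1 n2.
have inB y t : ball y0 rho y -> `|t - t0| < rho -> ball x0 rho (insert j y t).
  move=> /ballE yr tr; apply/ballE.
  by rewrite -(insert_col' j x0) insertB norm_insert_lt.
have mono y t1 t2 : ball y0 rho y -> `|t1 - t0| < rho -> `|t2 - t0| < rho ->
    t1 < t2 -> g (insert j y t1) < g (insert j y t2).
  move=> yr; rewrite !ltr_norml => /andP[? ?] /andP[? ?] t12; rewrite !insertE.
  have B t : t1 <= t <= t2 -> ball x0 rho (insert0 j y + t *: e_j).
    by move=> /andP[? ?]; rewrite -insertE; apply: inB => //; rewrite ltr_norml; lra.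
  by apply: line_increasing => // t /B/Hrho[Ut D]//; exact: dg.
have zero y s : ball y0 rho y -> 0 < s -> s < rho ->
    g (insert j y (t0 - s)) <= 0 -> 0 <= g (insert j y (t0 + s)) ->
    exists2 t, `|t - t0| < rho & g (insert j y t) = 0.
  move=> yr s0 sr; rewrite !insertE => ga gb.
  have [||t /andP[t1 t2] gt] := line_zero _ _ ga gb.
  - by lra.
  - move=> t /andP[? ?]; have /Hrho[Ut _] : ball x0 rho (insert0 j y + t *: e_j).
      by rewrite -insertE; apply: inB => //; rewrite ltr_norml; lra.
    exact: dg.
  - by exists t; rewrite ?insertE//; rewrite ltr_norml; lra.
have cg y t : ball y0 rho y -> `|t - t0| < rho ->
    {for y, continuous (fun y => g (insert j y t))}.
  move=> yr tr; apply: continuous_comp.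
    by apply: (@graph_map_cvg R n j (cst t)); exact: cst_continuous.
  have [Ut _] := Hrho _ (inB _ _ yr tr).
  exact/differentiable_continuous/dg.
pose s := rho / 2; have s0 : 0 < s by rewrite divr_gt0.
have sr : s < rho by rewrite /s; lra.
have bs e : `|e| < rho -> `|t0 + e - t0| < rho by rewrite addrAC subrr add0r.
have y0r : ball y0 rho y0 by exact: ballxx.
have gx0 : g (insert j y0 t0) = 0 by rewrite insert_col'.
have t0r : `|t0 - t0| < rho by rewrite subrr normr0.
have sr1 : `|t0 + s - t0| < rho by apply: bs; rewrite gtr0_norm.
have sr2 : `|t0 - s - t0| < rho by apply: bs; rewrite normrN gtr0_norm.
have [r [r0 rr Hr]] : exists r, [/\ 0 < r, r <= rho & forall y, ball y0 r y ->
    g (insert j y (t0 - s)) < 0 /\ 0 < g (insert j y (t0 + s))].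
  have n1 : nbhs y0 [set y | g (insert j y (t0 - s)) < 0].
    apply: (continuous_at_lt (cg _ _ y0r sr2)); rewrite -gx0; apply: mono => //.
    by rewrite ltrBlDr ltrDl.
  have n2 : nbhs y0 [set y | 0 < g (insert j y (t0 + s))].
    apply: (continuous_at_gt (cg _ _ y0r sr1)); rewrite -gx0; apply: mono => //.
    by rewrite ltrDl.
  have [e e0 He] := nbhs_ballI n1 n2.
  exists (Num.min e rho); split; first by rewrite lt_min e0.
    by rewrite ge_min lexx orbT.
  move=> y yr; apply: He; apply: le_ball yr.
  by rewrite ge_min lexx.
(* The zero on the vertical segment over y; t0 is a default outside the ball. *)
pose h y := xget t0 [set t | `|t - t0| < rho /\ g (insert j y t) = 0].
have hP y : ball y0 r y -> `|h y - t0| < rho /\ g (insert j y (h y)) = 0.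
  move=> yr; have [g1 g2] := Hr _ yr.
  have [t tr gt] := zero y s (le_ball rr yr) s0 sr (ltW g1) (ltW g2).
  exact: (@xgetPex _ t0 [set t | `|t - t0| < rho /\ g (insert j y t) = 0]
           (ex_intro _ t (conj tr gt))).
have hU y : ball y0 r y -> U (insert j y (h y)).
  move=> yr; have [hr _] := hP _ yr.
  by have [] := Hrho _ (inB _ _ (le_ball rr yr) hr).
have uniq y t : ball y0 r y -> `|t - t0| < rho -> g (insert j y t) = 0 -> h y = t.
  move=> yr tr gt; have [hr gh] := hP _ yr; have yr' := le_ball rr yr.
  have [lt|lt|//] := ltgtP (h y) t.
    by have := mono y _ _ yr' hr tr lt; rewrite gh gt ltxx.
  by have := mono y _ _ yr' tr hr lt; rewrite gh gt ltxx.
have oB : open (ball y0 r) by exact: ball_open.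
have ch y : ball y0 r y -> {for y, continuous h}.
  move=> yr; have [hr gh] := hP _ yr; have yr' := le_ball rr yr.
  apply/continuous_at_distP => e e0.
  pose d := Num.min (e / 2) ((rho - `|h y - t0|) / 2).
  have d0 : 0 < d by rewrite lt_min; apply/andP; split; lra.
  have de : d < e by apply: (@le_lt_trans _ _ (e / 2)); rewrite ?ge_min ?lexx//; lra.
  have dr : d + `|h y - t0| < rho.
    apply: (@le_lt_trans _ _ ((rho - `|h y - t0|) / 2 + `|h y - t0|)).
      by rewrite lerD2r ge_min lexx orbT.
    by lra.
  have h1 : `|h y - d - t0| < rho.
    by rewrite addrAC (le_lt_trans (ler_normB _ _))// (gtr0_norm d0) [ltLHS]addrC.
  have h2 : `|h y + d - t0| < rho.
    by rewrite addrAC (le_lt_trans (ler_normD _ _))// (gtr0_norm d0) [ltLHS]addrC.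
  have n1 : nbhs y [set z | g (insert j z (h y - d)) < 0].
    apply: (continuous_at_lt (cg _ _ yr' h1)); rewrite -gh; apply: mono => //.
    by rewrite ltrBlDr ltrDl.
  have n2 : nbhs y [set z | 0 < g (insert j z (h y + d))].
    apply: (continuous_at_gt (cg _ _ yr' h2)); rewrite -gh; apply: mono => //.
    by rewrite ltrDl.
  have n3 : nbhs y (ball y0 r) by exact: open_nbhs_nbhs.
  near=> z; have zr : ball y0 r z by near: z.
  have z1 : g (insert j z (h y - d)) < 0 by near: z.
  have z2 : 0 < g (insert j z (h y + d)) by near: z.
  have [hz gz] := hP _ zr; have zr' := le_ball rr zr.
  have l1 : h y - d < h z.
    rewrite ltNge; apply/negP; rewrite le_eqVlt => /orP[/eqP E|lt].
      by move: z1; rewrite /= -E gz ltxx.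
    by have := lt_trans (mono _ _ _ zr' hz h1 lt) z1; rewrite gz ltxx.
  have l2 : h z < h y + d.
    rewrite ltNge; apply/negP; rewrite le_eqVlt => /orP[/eqP E|lt].
      by move: z2; rewrite /= E gz ltxx.
    by have := lt_trans z2 (mono _ _ _ zr' h2 hz lt); rewrite gz ltxx.
  by rewrite ltr_norml; lra.
have dh y : ball y0 r y -> differentiable h y /\ forall v, 'D_v h y =
    - ('D_e_j g (insert j y (h y)))^-1 * 'D_(insert0 j v) g (insert j y (h y)).
  move=> yr; apply: implicit_diff.
  - exact: ch.
  - have : nbhs y (ball y0 r) by exact: open_nbhs_nbhs.
    by apply: filterS => z /hP[].
  - exact/dg/hU.
  - have [hr _] := hP _ yr; have [_] := Hrho _ (inB _ _ (le_ball rr yr) hr).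
    by rewrite lt0r => /andP[].
exists r, h; split => //.
- have : (k.+1 <= k.+1)%N by [].
  (* Regularity l of h gives regularity l of the formula for its derivatives, as
     long as g still has l + 1 derivatives. *)
  move: {-2}(k.+1) => l; elim: l => [_ y yr|l IH lk]; first exact: ch.
  have Cl := IH (ltnW lk); split => [y yr|v]; first exact: (dh y yr).1.
  have D0' y : ball y0 r y -> 'D_e_j g (insert j y (h y)) != 0.
    move=> yr; have [hr _] := hP _ yr.
    have [_] := Hrho _ (inB _ _ (le_ball rr yr) hr).
    by rewrite lt0r => /andP[].
  have C1 := Ck_on_graph oB hU (Ck_on_le (ltnSE lk) (Dg e_j)) Cl.
  have C2 := Ck_on_graph oB hU (Ck_on_le (ltnSE lk) (Dg (insert0 j v))) Cl.
  have C3 := Ck_onM oB (Ck_onM oB (@Ck_on_cst _ _ _ l (ball y0 r) (-1 : R))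
    (Ck_onV oB D0' C1)) C2.
  apply: Ck_on_ext C3 => // y yr.
  by rewrite (dh y yr).2 /= mulN1r.
- move=> x /ballE xr gx; apply: uniq; last by rewrite insert_col'.
    apply/ballE; rewrite /y0.
    have -> : col' j x - col' j x0 = col' j (x - x0) by apply/rowP => i; rewrite !mxE.
    exact: le_lt_trans (norm_col' _ _) xr.
  have -> : x 0 j - t0 = (x - x0) 0 j by rewrite !mxE.
  exact: le_lt_trans (rV_coord_le _ _) (lt_le_trans xr rr).
Unshelve. all: by end_near. Qed.

Lemma implicit_function k (U : set 'rV[R]_n.+1) (g : 'rV[R]_n.+1 -> R) x0 :
  open U -> U x0 -> Ck_on k.+1 U g -> g x0 = 0 -> 'D_e_j g x0 != 0 ->
  exists r (h : 'rV[R]_n -> R),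
    [/\ 0 < r, Ck_on k.+1 (ball (col' j x0) r) h,
      forall y, ball (col' j x0) r y -> U (insert j y (h y)) &
      forall x, ball x0 r x -> g x = 0 -> h (col' j x) = x 0 j].
Proof.
move=> oU Ux0 Cg g0; rewrite neq_lt => /orP[D0|]; last exact: implicit_function_pos Cg g0.
have CN := Ck_onM oU (@Ck_on_cst _ _ _ k.+1 U (-1 : R)) Cg.
have [||r [h [r0 Ch hU hx]]] := implicit_function_pos oU Ux0 CN.
- by rewrite g0 mulr0.
- have dgx : derivable g x0 e_j by apply: diff_derivable; exact: Cg.1.
  have -> : (fun x => cst (-1) x * g x) = (-1 \*o g) by [].
  by rewrite deriveMl// mulN1r oppr_gt0.
- by exists r, h; split => // x xr gx; apply: hx => //; rewrite gx mulr0.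
Qed.

End ImplicitExists.

(** * Mean value and uniformity estimates *)

Section Calculus.
Variables (R : realType).

(** Uniform continuity on a compact set K where only one of the two points has to
be in K. *)
Lemma compact_uniform (V : normedModType R) (K : set V) (f : V -> R) :
  compact K -> (forall x, K x -> {for x, continuous f}) ->
  forall e : R, 0 < e -> exists2 d : R, 0 < d &
    forall y x, K y -> `|x - y| < d -> `|f x - f y| < e.
Proof.
move=> /compact_near_coveringP cK cf e e0.
pose P (d : R) (y : V) := forall x, `|x - y| < d -> `|f x - f y| < e.
have : \forall d \near 0^'+, K `<=` P d.
  apply: cK => x Kx.
  have e2 : 0 < e / 2 by rewrite divr_gt0.
  have /nbhs_ballP[r r0 Hr] := (continuous_at_distP _ _).1 (cf x Kx) _ e2.
  have r2 : 0 < r / 2 by rewrite divr_gt0.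
  have n1 : nbhs x (ball x (r / 2)) by exact: nbhsx_ballx.
  have n2 : nbhs (0 : R)^'+ [set d | d < r / 2] by exact: nbhs_right_lt.
  exists (ball x (r / 2), [set d | d < r / 2]) => // -[y d] [/= /ballE xy dr] z zy.
  have B1 : `|f x - f z| < e / 2.
    apply: Hr; apply/ballE; rewrite -(subrK y z) -addrA.
    by rewrite (le_lt_trans (ler_normD _ _))//; lra.
  have B2 : `|f x - f y| < e / 2.
    by apply: Hr; apply/ballE; lra.
  have -> : f z - f y = (f x - f y) - (f x - f z) by ring.
  by rewrite (le_lt_trans (ler_normB _ _))//; lra.
move=> H; have [d [d0 Hd]] : exists d : R, 0 < d /\ K `<=` P d.
  near (0 : R)^'+ => d; exists d; split; near: d => //.
  exact: nbhs_right_gt.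
by exists d => // y x Ky; exact: Hd.
Unshelve. all: by end_near. Qed.

Lemma nbhs_forall (V : normedModType R) (I : finType) (P : I -> set V) (x : V) :
  (forall i, nbhs x (P i)) -> nbhs x [set y | forall i, P i y].
Proof. by move=> H; apply: filter_forall. Qed.

(** Finitely many positive radii have a positive lower bound. *)
Lemma finite_common_radius n (P : 'I_n -> R -> Prop) :
  (forall i d d', 0 < d' -> d' <= d -> P i d -> P i d') ->
  (forall i, exists2 d : R, 0 < d & P i d) ->
  exists2 d : R, 0 < d & forall i, P i d.
Proof.
move=> mono H.
have H1 : forall i, \forall d \near (0 : R)^'+, P i d.
  move=> i; have [d d0 Pd] := H i.
  near=> d'; apply: (mono i d) => //; apply/ltW; near: d'.
    exact: nbhs_right_lt.
have H2 : \forall d \near (0 : R)^'+, forall i, P i d by exact: filter_forall.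
near (0 : R)^'+ => d; exists d; last by near: d.
by near: d; exact: nbhs_right_gt.
Unshelve. all: by end_near. Qed.

Lemma derive_coord n (W : normedModType R) (f : 'rV[R]_n -> W) x w :
  differentiable f x ->
  'D_w f x = \sum_(i < n) w 0 i *: 'D_(delta_mx 0 i) f x.
Proof.
move=> df; rewrite (deriveE _ df) {1}(row_sum_delta w) linear_sum.
by apply: eq_bigr => i _; rewrite linearZZ -(deriveE _ df).
Qed.

Lemma derive_bound n (f : 'rV[R]_n -> R) x w (b : R) : differentiable f x ->
  (forall i, `|'D_(delta_mx 0 i) f x| <= b) -> `|'D_w f x| <= n%:R * b * `|w|.
Proof.
move=> df Hb; rewrite (derive_coord _ df) (le_trans (ler_norm_sum _ _ _))//.
have -> : n%:R * b * `|w| = \sum_(i < n) (b * `|w|).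
  by rewrite sumr_const card_ord -mulrA mulr_natl.
apply: ler_sum => i _; rewrite normrM mulrC; apply: ler_pM => //.
exact: rV_coord_le.
Qed.

(** The partial derivatives are continuous, hence bounded near y0 by their values
at y0 plus one. *)
Lemma C1_locally_bounded n (U : set 'rV[R]_n) (h : 'rV[R]_n -> R) y0 :
  open U -> U y0 -> Ck_on 1 U h ->
  exists r K : R, [/\ 0 < r, 0 < K & forall y, ball y0 r y ->
    U y /\ forall v, `|'D_v h y| <= K * `|v|].
Proof.
move=> oU Uy0 [dh Dh].
pose b := \sum_(i < n) (`|'D_(delta_mx 0 i) h y0| + 1).
have bi i : `|'D_(delta_mx 0 i) h y0| + 1 <= b.
  rewrite /b (bigD1 i)//= lerDl; apply: sumr_ge0 => k _.
  by rewrite addr_ge0.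
have b0 : 0 <= b by apply: sumr_ge0 => i _; rewrite addr_ge0.
have n1 : nbhs y0 U by exact: open_nbhs_nbhs.
have n2 : nbhs y0 [set y | forall i, `|'D_(delta_mx 0 i) h y0 - 'D_(delta_mx 0 i) h y| < 1].
  apply: nbhs_forall => i.
  exact: ((continuous_at_distP _ _).1 (Dh (delta_mx 0 i) y0 Uy0) 1 ltr01).
have [r r0 Hr] := nbhs_ballI n1 n2.
exists r, (n%:R * b + 1); split => //.
  by rewrite ltr_wpDl// mulr_ge0.
move=> y /Hr[Uy Hy]; split => // v.
apply: (@le_trans _ _ (n%:R * b * `|v|)).
  apply: derive_bound; first exact: dh.
  move=> i; apply: le_trans (bi i).
  have -> : 'D_(delta_mx 0 i) h y = 'D_(delta_mx 0 i) h y0 -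
     ('D_(delta_mx 0 i) h y0 - 'D_(delta_mx 0 i) h y) by ring.
  rewrite (le_trans (ler_normB _ _))// lerD2l; exact: ltW (Hy i).
by rewrite ler_wpM2r// lerDl.
Qed.

Lemma line_mean_value (V : normedModType R) (f : V -> R) (x v : V) (b : R) :
  (forall t, 0 <= t <= 1 -> differentiable f (x + t *: v)) ->
  (forall t, 0 <= t <= 1 -> `|'D_v f (x + t *: v)| <= b) ->
  `|f (x + v) - f x| <= b.
Proof.
move=> df Df.
have [||c] := @MVT R (fun t => f (x + t *: v)) (fun t => 'D_v f (x + t *: v)) 0 1 ltr01.
- move=> t; rewrite in_itv/= => /andP[at_ tb]; apply/line_is_derive/df.
  by rewrite !ltW.
- apply: derivable_within_continuous => t tab; apply: ex_derive.
  by apply/line_is_derive/df; move: tab; rewrite in_itv.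
- rewrite in_itv/= scale1r scale0r addr0 subr0 mulr1 => /andP[ac cb] ->.
  by apply: Df; rewrite !ltW.
Qed.

End Calculus.

(** * The lemma of A. P. Morse *)

Section Morse.
Variables (R : realType).

(** The data of one piece of Morse's decomposition: psi maps the bounded convex set B to
U, with bounded derivative, the points of Z go to A, and each C^k function that
vanishes on A is o(|x - y|^k) along psi, uniformly for y in Z and x in B.  The
estimate concerns all x in B, not only those of Z: it is integrated along segments
of B in [flat_chart_increment]. *)
Definition flat_chart n m k (U A : set 'rV[R]_n) (B Z : set 'rV[R]_m)
    (psi : 'rV[R]_m -> 'rV[R]_n) : Prop :=
  [/\ (forall x y t, B x -> B y -> 0 <= t <= 1 -> B (x + t *: (y - x))) /\
        (exists M : R, forall x, B x -> `|x| <= M),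
      exists C : R, forall x, B x -> [/\ U (psi x), differentiable psi x &
        forall v, `|'D_v psi x| <= C * `|v|],
      forall y, Z y -> B y /\ A (psi y) &
      forall f : 'rV[R]_n -> R, Ck_on k U f -> (forall x, A x -> f x = 0) ->
      forall e : R, 0 < e -> exists2 d : R, 0 < d &
        forall y x, Z y -> B x -> `|x - y| < d ->
          `|f (psi x)| <= e * `|x - y| ^+ k].

(** The dimension m of the parameter space may drop below n; pieces of dimension 0 are
points. *)
Definition flat_piece n k (U A Z : set 'rV[R]_n) : Prop :=
  exists m (B Zm : set 'rV[R]_m) (psi : 'rV[R]_m -> 'rV[R]_n),
  [/\ (m <= n)%N, flat_chart k U A B Zm psi & Z `<=` psi @` Zm].

(** The sets covered by countably many pieces form a sigma-ideal, which is what allows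
local arguments. *)
Definition flat_union n k (U A Z : set 'rV[R]_n) : Prop :=
  exists2 F : nat -> set 'rV[R]_n, Z `<=` \bigcup_i F i &
    forall i, flat_piece k U A (F i).

Lemma flat_piece0 n k (U A : set 'rV[R]_n) : flat_piece k U A set0.
Proof.
exists 0%N, set0, set0, (fun=> 0); split => //.
split => //; [by split => //; exists 0|by exists 0|].
by move=> f _ _ e e0; exists 1.
Qed.

Lemma flat_union_piece n k (U A Z : set 'rV[R]_n) :
  flat_piece k U A Z -> flat_union k U A Z.
Proof. by exists (fun=> Z) => // x Zx; exists 0%N. Qed.

Lemma flat_unionS n k (U A Z Z' : set 'rV[R]_n) :
  Z' `<=` Z -> flat_union k U A Z -> flat_union k U A Z'.
Proof. by move=> ZZ [F ZF PF]; exists F => // x /ZZ/ZF. Qed.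

Lemma flat_union_bigcup n k (U A : set 'rV[R]_n) (Z : nat -> set 'rV[R]_n) :
  (forall i, flat_union k U A (Z i)) -> flat_union k U A (\bigcup_i Z i).
Proof.
move=> H; pose F i := s2val (cid2 (H i)).
have ZF i : Z i `<=` \bigcup_j F i j by exact: s2valP (cid2 (H i)).
have PF i j : flat_piece k U A (F i j) by exact: s2valP' (cid2 (H i)) j.
exists (fun a => if unpickle a is Some ij then F ij.1 ij.2 else set0).
  move=> x [i _ /ZF[j _ Fx]]; exists (pickle (i, j)) => //.
  by rewrite pickleK.
by move=> a; case: unpickle => [ij|]; [exact: PF|exact: flat_piece0].
Qed.

Lemma flat_union_local n k (U A Z : set 'rV[R]_n) :
  (forall x, Z x -> exists2 N, nbhs x N & flat_union k U A (Z `&` N)) ->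
  flat_union k U A Z.
Proof.
apply: lindelof_ideal.
- exact/flat_union_piece/flat_piece0.
- exact: flat_union_bigcup.
- by move=> A0 B0 AB; exact: flat_unionS AB.
Qed.

Lemma flat_unionU n k (U A Z Z' : set 'rV[R]_n) : flat_union k U A Z ->
  flat_union k U A Z' -> flat_union k U A (Z `|` Z').
Proof.
move=> H H'; have : flat_union k U A (\bigcup_(i : nat) (if i is 0%N then Z else Z')).
  by apply: flat_union_bigcup => -[].
by apply: flat_unionS => x [Zx|Zx]; [exists 0%N|exists 1%N].
Qed.

Lemma closed_ball_compact n (x : 'rV[R]_n) (r : R) :
  compact [set y : 'rV[R]_n | `|y - x| <= r].
Proof.
apply: bounded_closed_compact.
  exists (`|x| + r); split; first by rewrite num_real.
  move=> M HM y /= yx; rewrite -(subrK x y) (le_trans (ler_normD _ _))//.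
  by rewrite addrC (le_trans _ (ltW HM))// lerD2l.
have -> : [set y : 'rV[R]_n | `|y - x| <= r] = closed_ball_ (fun y : 'rV[R]_n => `|y|) x r.
  by apply/seteqP; split => y /=; rewrite distrC.
exact: closed_closed_ball_.
Qed.

(** For k = 0 the estimate says that a continuous function vanishing on A is small
near A, uniformly.  The identity on a small closed ball is a chart, by uniform
continuity. *)
Lemma flat_union_C0 n (U A : set 'rV[R]_n) : open U -> A `<=` U ->
  flat_union 0 U A A.
Proof.
move=> oU AU; apply: flat_union_local => x Ax.
have /nbhs_ballP[r r0 rU] : nbhs x U by exact/open_nbhs_nbhs/(conj oU (AU x Ax)).
have r2 : 0 < r / 2 by rewrite divr_gt0.
pose B := [set y : 'rV[R]_n | `|y - x| <= r / 2].
exists (ball x (r / 2)); first exact: nbhsx_ballx.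
apply: flat_union_piece.
exists n, B, (A `&` B), id; split => //; last first.
  by move=> y [Ay /ballE yr]; exists y => //; split => //; exact: ltW.
split => //.
- split=> [y z t By Bz /andP[t0 t1]|]; last first.
    exists (`|x| + r / 2) => y By.
    by rewrite -(subrK x y) (le_trans (ler_normD _ _))// addrC lerD2l; exact: By.
    rewrite /B /=; have -> : y + t *: (z - y) - x = (1 - t) *: (y - x) + t *: (z - x).
      by apply/rowP => i; rewrite !mxE; ring.
    rewrite (le_trans (ler_normD _ _))// !normrZ (ger0_norm t0) ger0_norm ?subr_ge0//.
    have : (1 - t) * `|y - x| <= (1 - t) * (r / 2) by rewrite ler_wpM2l ?subr_ge0.
    have : t * `|z - x| <= t * (r / 2) by rewrite ler_wpM2l.
    by lra.
- exists 1 => y By; split; first by apply: rU; apply/ballE; move: By; rewrite /B/=; lra.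
    by [].
  by move=> v; rewrite derive_id mul1r.
- by move=> y [].
move=> f Cf f0 e e0.
have cf y : B y -> {for y, continuous f}.
  by move=> By; apply: Cf; apply: rU; apply/ballE; move: By; rewrite /B/=; lra.
have [d d0 Hd] := compact_uniform (@closed_ball_compact n x (r / 2)) cf e0.
exists d => // y z [Ay By] Bz zy; rewrite expr0 mulr1.
by have := Hd y z By zy; rewrite (f0 y Ay) subr0 => /ltW.
Qed.

(** The derivatives of f vanish on A and are of class C^k, so they are
o(|x - y|^k) along the chart; integrating them along the segment from y to x, which
stays in B, gains one power of |x - y|. *)
Lemma flat_chart_increment n m k (U A : set 'rV[R]_n) (B Z : set 'rV[R]_m)
    (psi : 'rV[R]_m -> 'rV[R]_n) (f : 'rV[R]_n -> R) :
  flat_chart k U A B Z psi -> Ck_on k.+1 U f ->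
  (forall x v, A x -> 'D_v f x = 0) ->
  forall e : R, 0 < e -> exists2 d : R, 0 < d &
    forall y x, Z y -> B x -> `|x - y| < d ->
      `|f (psi x) - f (psi y)| <= e * `|x - y| ^+ k.+1.
Proof.
move=> [[convB _] [C HB] ZB flat] [df Df] crit e e0.
(* n and C come from the bounds of [derive_bound] and of the derivative of psi;
   the summand 1 makes C' positive. *)
pose C' := n%:R * `|C| + 1.
have C'0 : 0 < C' by rewrite ltr_wpDl// mulr_ge0.
have eC : 0 < e / C' by rewrite divr_gt0.
pose P (i : 'I_n) d := forall y x, Z y -> B x -> `|x - y| < d ->
  `|'D_(delta_mx 0 i) f (psi x)| <= e / C' * `|x - y| ^+ k.
have [|i|d d0 Hd] := @finite_common_radius R n P.
- by move=> i d d' d'0 dd Pd y x Zy Bx xy; apply: Pd => //; exact: lt_le_trans xy dd.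
- exact: flat (Df (delta_mx 0 i)) (fun x => crit x _) _ eC.
exists d => // y x Zy Bx xy; have [By Ay] := ZB y Zy.
have -> : psi x = psi (y + (x - y)) by rewrite addrC subrK.
have Bt t : 0 <= t <= 1 -> B (y + t *: (x - y)) by exact: convB.
apply: (@line_mean_value _ _ (f \o psi)) => t t01.
  by have [Ux dpsi _] := HB _ (Bt t t01); apply: differentiable_comp => //; exact: df.
have [Ux dpsi Dpsi] := HB _ (Bt t t01); have [t0 t1] := andP t01.
set z := y + t *: (x - y) in Ux dpsi Dpsi *.
have zy : `|z - y| <= `|x - y|.
  by rewrite /z addrC addKr normrZ ger0_norm// ler_piMl.
rewrite (derive_comp _ dpsi (df _ Ux)).
have Db i : `|'D_(delta_mx 0 i) f (psi z)| <= e / C' * `|x - y| ^+ k.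
  apply: (le_trans (Hd i y z Zy (Bt t t01) (le_lt_trans zy xy))).
  by rewrite ler_pM2l// lerXn2r// nnegrE.
apply: (le_trans (derive_bound _ (df _ Ux) Db)).
have w0 : `|'D_(x - y) psi z| <= `|C| * `|x - y|.
  by apply: (le_trans (Dpsi _)); rewrite ler_wpM2r// ler_norm.
have c0 : 0 <= n%:R * (e / C' * `|x - y| ^+ k).
  by rewrite mulr_ge0// mulr_ge0 ?exprn_ge0// ltW.
apply: (le_trans (ler_wpM2l c0 w0)).
have -> : n%:R * (e / C' * `|x - y| ^+ k) * (`|C| * `|x - y|) =
   (e / C' * (n%:R * `|C|)) * `|x - y| ^+ k.+1 by rewrite exprS; ring.
rewrite ler_wpM2r ?exprn_ge0// -mulrA ger_pMr// mulrC ler_pdivrMr// mul1r.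
by rewrite /C' lerDl.
Qed.

(** If the functions of class C^k.+1 vanishing on A are critical on A', then a piece
for A' in class C^k is a piece for A in class C^k.+1: since f (psi y) = 0, the
increment bounded by [flat_chart_increment] is f (psi x) itself. *)
Lemma flat_piece_succ n k (U A A' Z : set 'rV[R]_n) : A' `<=` A ->
  (forall f : 'rV[R]_n -> R, Ck_on k.+1 U f -> (forall x, A x -> f x = 0) ->
    forall x v, A' x -> 'D_v f x = 0) ->
  flat_piece k U A' Z -> flat_piece k.+1 U A Z.
Proof.
move=> A'A crit [m [B [Zm [psi [mn Hc Zpsi]]]]].
have [cB HB ZB _] := Hc.
exists m, B, Zm, psi; split => //; split => //.
  by move=> y /ZB[By /A'A Ay].
move=> f Cf f0 e e0.
have [d d0 Hd] := flat_chart_increment Hc Cf (crit f Cf f0) e0.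
exists d => // y x Zy Bx xy; have [By Ay] := ZB y Zy.
by have := Hd y x Zy Bx xy; rewrite (f0 _ (A'A _ Ay)) subr0.
Qed.

(** Pieces inside a hypersurface are pieces of the ambient space: f restricted to the
graph of h is again of class C^k, and it vanishes on the trace of A. *)
Lemma flat_piece_graph n (j : 'I_n.+1) k (U A : set 'rV[R]_n.+1) (V : set 'rV[R]_n)
    (h : 'rV[R]_n -> R) (K : R) (Z : set 'rV[R]_n) :
  open V -> Ck_on k.+1 V h -> 0 < K ->
  (forall y, V y -> U (insert j y (h y)) /\ forall v, `|'D_v h y| <= K * `|v|) ->
  flat_piece k.+1 V (V `&` [set y | A (insert j y (h y))]) Z ->
  flat_piece k.+1 U A ((fun y => insert j y (h y)) @` Z).
Proof.
move=> oV Ch K0 hU [m [B [Zm [psi [mn [cB [C HB] ZB flat] Zpsi]]]]].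
exists m, B, Zm, (fun x => insert j (psi x) (h (psi x))); split.
- exact: leqW.
- split => //; first exists ((1 + K) * C).
  move=> x Bx; have [Vx dpsi Dpsi] := HB x Bx; have [Ux Kx] := hU _ Vx.
  have dh : differentiable h (psi x) by exact: Ch.1.
  have [dg Dg] := graph_map_diff j dh.
  split => //.
    exact: (@differentiable_comp _ _ _ _ psi (fun y => insert j y (h y))).
  move=> v; rewrite (@derive_comp _ _ _ _ psi (fun y => insert j y (h y)))//.
  rewrite Dg (le_trans (norm_insert _ _ _))//.
  set w := 'D_v psi x; have := Kx w; have := Dpsi v; rewrite -/w => H1 H2.
  have H3 : (1 + K) * `|w| <= (1 + K) * (C * `|v|).
    by rewrite ler_pM2l//; lra.
  by lra.
  + by move=> y /ZB[By [_ Ay]].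
  + move=> f Cf f0.
    have Cfh := Ck_on_graph oV (fun y Vy => (hU y Vy).1) Cf Ch.
    by apply: (flat _ Cfh) => y [_ /f0].
- by move=> _ [y /Zpsi[x Zx <-] <-]; exists x.
Qed.

(** Induction on (n, k) in lexicographic order, starting from [flat_union_C0] when
k = 0.  For k > 0 let A' be the set of the points
of A where every C^k function vanishing on A is critical.  On A' the decomposition
for (n, k-1) can be used, by [flat_piece_succ].  Near a point of A outside A', the set
A lies in a regular hypersurface {g = 0}, a graph over R^(n-1) by the implicit
function theorem, and the decomposition for (n-1, k) can be used, by
[flat_piece_graph]. *)
Lemma morse_lemma n k (U A : set 'rV[R]_n) : open U -> A `<=` U ->
  flat_union k U A A.
Proof.
elim: n k U A => [|n IHn]; elim=> [|k IHk] U A oU AU; try exact: flat_union_C0.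
  have [F AF PF] := IHk U A oU AU; exists F => // i.
  apply: flat_piece_succ (PF i) => // f _ _ x v _.
  (* In R^0 every function is critical everywhere, so A' = A. *)
  have -> : v = 0 by apply/rowP => -[].
  exact: derive0.
pose A' := A `&` [set x | forall f : 'rV[R]_n.+1 -> R, Ck_on k.+1 U f ->
  (forall x, A x -> f x = 0) -> forall v, 'D_v f x = 0].
have A'A : A' `<=` A by move=> x [].
have H' : flat_union k.+1 U A A'.
  have [F AF PF] := IHk U A' oU (subset_trans A'A AU); exists F => // i.
  by apply: flat_piece_succ (PF i) => // f Cf f0 x v [_]; exact.
have H'' : flat_union k.+1 U A (A `\` A').
  apply: flat_union_local => x0 [Ax0 nA'].
  have [g [Cg g0 [v Dv]]] : exists g : 'rV[R]_n.+1 -> R,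
      [/\ Ck_on k.+1 U g, forall x, A x -> g x = 0 & exists v, 'D_v g x0 != 0].
    apply: contrapT => H; apply: nA'; split => // f Cf f0 v.
    apply: contrapT => /eqP Dv; apply: H; exists f; split => //; by exists v.
  have Ux0 := AU _ Ax0.
  have [j Dj] : exists j, 'D_(delta_mx 0 j) g x0 != 0.
    apply: contrapT => H; move/negP: Dv; apply; apply/eqP.
    rewrite (derive_coord _ (Cg.1 _ Ux0)) big1// => i _.
    have [->|/eqP Di] := pselect ('D_(delta_mx 0 i) g x0 = 0); first by rewrite scaler0.
    by exfalso; apply: H; exists i.
  have [r [h [r0 Ch hU hx]]] := implicit_function oU Ux0 Cg (g0 _ Ax0) Dj.
  have oB : open (ball (col' j x0) r) by exact: ball_open.
  have cB : ball (col' j x0) r (col' j x0) by exact: ballxx.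
  have [r' [K [r'0 K0 HK]]] := C1_locally_bounded oB cB (Ck_on_le (ltn0Sn k) Ch).
  pose V := ball (col' j x0) r'.
  have oV : open V by exact: ball_open.
  have ChV : Ck_on k.+1 V h by apply: Ck_on_sub Ch => y /HK[].
  have HV y : V y -> U (insert j y (h y)) /\ forall v, `|'D_v h y| <= K * `|v|.
    by move=> /HK[yr Ky]; split => //; exact: hU.
  have [F AF PF] := IHn k.+1 V (V `&` [set y | A (insert j y (h y))]) oV
    (@subIsetl _ _ _).
  exists (ball x0 (Num.min r r')).
    by apply: nbhsx_ballx; rewrite lt_min r0.
  exists (fun i => (fun y => insert j y (h y)) @` F i); last first.
    by move=> i; exact: (flat_piece_graph oV ChV K0 HV (PF i)).
  move=> x [[Ax _] xr].
  have xr1 : ball x0 r x by apply: le_ball xr; rewrite ge_min lexx.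
  have xr2 : ball x0 r' x by apply: le_ball xr; rewrite ge_min lexx orbT.
  have hE := hx x xr1 (g0 x Ax).
  have xE : insert j (col' j x) (h (col' j x)) = x by rewrite hE insert_col'.
  have : (V `&` [set y | A (insert j y (h y))]) (col' j x).
    split; last by rewrite /= xE.
    apply/ballE; move/ballE: xr2; apply: le_lt_trans.
    have -> : col' j x - col' j x0 = col' j (x - x0) by apply/rowP => i; rewrite !mxE.
    exact: norm_col'.
  by move=> /AF[i _ Fi]; exists i => //; exists (col' j x).
apply: flat_unionS (flat_unionU H' H'') => x Ax.
by have [?|?] := pselect (A' x); [left|right].
Qed.

End Morse.

(** * The Morse-Sard theorem for real functions *)

Section Negligible.
Variable (R : realType).
Local Notation mu := (@lebesgue_measure R).

Lemma negligible_eps (A : set R) :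
  (forall e : R, 0 < e -> exists T : set R,
    [/\ measurable T, A `<=` T & (mu T <= e%:E)%E]) -> mu.-negligible A.
Proof.
move=> H.
have Hk (k : nat) : 0 < k.+1%:R^-1 :> R by rewrite invr_gt0 ltr0n.
pose T k := sval (cid (H _ (Hk k))).
have TP k : [/\ measurable (T k), A `<=` T k & (mu (T k) <= (k.+1%:R^-1)%:E)%E].
  exact: svalP (cid (H _ (Hk k))).
have mT : measurable (\bigcap_k T k).
  by apply: bigcapT_measurable => k; have [] := TP k.
exists (\bigcap_k T k); split => //; last first.
  by move=> x Ax k _; have [_ + _] := TP k; exact.
apply/eqP; rewrite eq_le measure_ge0 andbT; apply/lee_addgt0Pr => e e0.
rewrite add0e.
pose k := Num.trunc e^-1.
have ke : k.+1%:R^-1 <= e :> R.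
  by rewrite invf_ple ?posrE ?ltr0n// ltW// truncnS_gt.
have [mk _ ek] := TP k.
apply: (@le_trans _ _ (mu (T k))); last by rewrite (le_trans ek)// lee_fin.
by apply: le_measure; rewrite ?inE// => x; exact.
Qed.

Lemma measure_bigU_le (I : Type) (s : seq I) (J : I -> set R) (b : R) :
  (forall i, measurable (J i)) -> (forall i, (mu (J i) <= b%:E)%E) ->
  (mu (\big[setU/set0]_(i <- s) J i) <= ((size s)%:R * b)%:E)%E.
Proof.
move=> mJ Jb; elim: s => [|i s IH]; first by rewrite big_nil measure0 mul0r.
rewrite big_cons (le_trans (measureU2 _ _ _))//.
- exact: mJ.
- by apply: bigsetU_measurable => ? _; exact: mJ.
rewrite /= -natr1 mulrDl mul1r addrC EFinD; apply: leeD => //.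
Qed.

(** Cut the cube [-L, L]^m, which contains Z, into N^m cells of side s = 2L/N.  For s
small, G oscillates by at most e s^m on each cell, so its image is covered by N^m
intervals of length 2 e s^m, of total length 2 e (2L)^m. *)
Lemma flat_image_negligible m (Z : set 'rV[R]_m) (G : 'rV[R]_m -> R) (M : R) :
  (forall y, Z y -> `|y| <= M) ->
  (forall e : R, 0 < e -> exists2 d : R, 0 < d & forall x y, Z x -> Z y ->
    `|x - y| < d -> `|G x - G y| <= e * `|x - y| ^+ m) ->
  mu.-negligible (G @` Z).
Proof.
move=> ZM flat; apply: negligible_eps => eta eta0.
(* The strict inequality M < L keeps the cell indices below N. *)
pose L := `|M| + 1.
have L0 : 0 < L by rewrite ltr_wpDl.
have ML : M < L by rewrite (le_lt_trans (ler_norm M))// ltrDl.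
pose e := eta / (2 * (2 * L) ^+ m).
have L20 : 0 < 2 * (2 * L) ^+ m by rewrite mulr_gt0// exprn_gt0// mulr_gt0.
have e0 : 0 < e by rewrite divr_gt0.
have [d d0 Hd] := flat e e0.
pose N := (Num.trunc (2 * L / d)).+1.
have N0 : 0 < N%:R :> R by rewrite ltr0n.
pose s := 2 * L / N%:R.
have s0 : 0 < s by rewrite divr_gt0// mulr_gt0.
have sd : s < d.
  by rewrite ltr_pdivrMr// [d * _]mulrC -ltr_pdivrMr// truncnS_gt.
pose cell (c : {ffun 'I_m -> 'I_N}) := Z `&`
  [set y : 'rV[R]_m | forall i, (c i)%:R * s <= y 0 i + L < (c i).+1%:R * s].
have cellZ y : Z y -> exists c, cell c y.
  move=> Zy.
  pose q i := (y 0 i + L) / s.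
  have yi i : 0 <= q i /\ (Num.trunc (q i) < N)%N.
    have := le_trans (rV_coord_le y i) (ZM y Zy); rewrite ler_norml => /andP[y1 y2].
    have ys : 0 <= q i by rewrite divr_ge0 ?(ltW s0)//; lra.
    split => //; rewrite -(ltr_nat R) (@le_lt_trans _ _ (q i))//.
      by rewrite truncn_le.
    rewrite /q ltr_pdivrMr// /s mulrCA divff ?gt_eqF// mulr1; lra.
  exists [ffun i => Ordinal (yi i).2]; split => // i; rewrite ffunE /=.
  by rewrite -ler_pdivlMr// -ltr_pdivrMr// truncn_le ?truncnS_gt ?andbT//; exact: (yi i).1.
have diam c x y : cell c x -> cell c y -> `|x - y| <= s.
  move=> [_ cx] [_ cy]; apply: rV_norm_le => [|i]; first exact: ltW.
  have := cx i; have := cy i; rewrite -natr1 !mulrDl mul1r !mxE.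
  move: ((c i)%:R * s) => a /andP[? ?] /andP[? ?].
  by rewrite ler_norml; lra.
pose b := e * s ^+ m.
have b0 : 0 < b by rewrite mulr_gt0// exprn_gt0.
pose J c := `[G (xget 0 (cell c)) - b, G (xget 0 (cell c)) + b]%classic.
have mJ c : measurable (J c) by exact: measurable_itv.
exists (\big[setU/set0]_(c <- enum {: {ffun 'I_m -> 'I_N}}) J c); split.
- by apply: bigsetU_measurable => c _.
- move=> _ [y Zy <-]; have [c cy] := cellZ y Zy.
  have cx : cell c (xget 0 (cell c)) by apply: xgetPex; exists y.
  rewrite (bigD1_seq c) ?mem_enum ?enum_uniq//=; left.
  rewrite /J /= in_itv/=; have xs := diam _ _ _ cy cx.
  have : `|G y - G (xget 0 (cell c))| <= b.
    apply: (le_trans (Hd _ _ Zy cx.1 (le_lt_trans xs sd))).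
    by rewrite /b ler_pM2l// lerXn2r ?nnegrE ?(ltW s0).
  by rewrite ler_norml => /andP[? ?]; apply/andP; split; lra.
- apply: (le_trans (@measure_bigU_le _ _ _ (2 * b) _ _)) => //.
    move=> c; rewrite lebesgue_measure_itv/= lte_fin ifT; last by lra.
    by rewrite -EFinB lee_fin; lra.
  rewrite lee_fin -cardE card_ffun !card_ord /b /s natrX.
  have -> : N%:R ^+ m * (2 * (e * (2 * L / N%:R) ^+ m)) =
    e * (2 * (2 * L) ^+ m) * (N%:R ^+ m / N%:R ^+ m) :> R.
    by rewrite expr_div_n; ring.
  rewrite divff ?mulr1 ?expf_neq0 ?gt_eqF//.
  by rewrite /e divfK// gt_eqF.
Qed.

(** Morse's theorem, with the sharp condition k >= n.  The derivatives of f are of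
class C^(k-1) and vanish on the critical set, so on a piece f oscillates like
o(|x - y|^k), and k is at least the dimension m of the parameter space of the
piece. *)
Theorem sard n k (U : set 'rV[R]_n) (f : 'rV[R]_n -> R) :
  open U -> (0 < k)%N -> (n <= k)%N -> Ck_on k U f ->
  mu.-negligible (f @` [set x | U x /\ forall v, 'D_v f x = 0]).
Proof.
move=> oU; case: k => // k _ nk Cf.
set A := [set x | _].
have [F AF PF] := @morse_lemma R n k U A oU (fun x => @proj1 _ _).
have sub : f @` A `<=` \bigcup_i (f @` F i).
  by move=> _ [x /AF[i _ Fx] <-]; exists i => //; exists x.
apply: (@negligibleS _ _ _ mu _ _ sub); apply: negligible_bigcup => i.
have [m [B [Z [psi [mn Hc FZ]]]]] := PF i.
have [[_ [M BM]] _ ZB _] := Hc.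
have {}sub : f @` F i `<=` (f \o psi) @` Z.
  by move=> _ [x /FZ[y Zy <-] <-]; exists y.
apply: (@negligibleS _ _ _ mu _ _ sub); apply: (@flat_image_negligible m Z (f \o psi) M).
  by move=> y /ZB[By _]; exact: BM.
move=> e e0.
have [d d0 Hd] := flat_chart_increment Hc Cf (fun x v Ax => Ax.2 v) e0.
exists (Num.min d 1); first by rewrite lt_min d0 ltr01.
move=> x y Zx Zy; rewrite lt_min => /andP[xd x1].
apply: (le_trans (Hd y x Zy (ZB x Zx).1 xd)); rewrite ler_pM2l//.
have mk : (m <= k.+1)%N by exact: leq_trans mn nk.
by rewrite ler_wiXn2l// ltW.
Qed.

End Negligible.

(** * The Euclidean scalar product *)

Section Dot.
Variables (R : realType) (m : nat).
Implicit Types u v w : 'rV[R]_m.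

Lemma dotpC u v : dotp u v = dotp v u.
Proof. by apply: eq_bigr => i _; rewrite mulrC. Qed.

Lemma dotpDl u v w : dotp (u + v) w = dotp u w + dotp v w.
Proof. by rewrite /dotp -big_split; apply: eq_bigr => i _; rewrite mxE mulrDl. Qed.

Lemma dotpZl a u w : dotp (a *: u) w = a * dotp u w.
Proof. by rewrite /dotp mulr_sumr; apply: eq_bigr => i _; rewrite mxE mulrA. Qed.

Lemma dotp0l w : dotp 0 w = 0.
Proof. by rewrite /dotp big1// => i _; rewrite mxE mul0r. Qed.

Lemma dotpE u v : dotp u v = (u *m v^T) 0 0.
Proof. by rewrite mxE; apply: eq_bigr => i _; rewrite mxE. Qed.

Lemma dotp_ge0 u : 0 <= dotp u u.
Proof. by apply: sumr_ge0 => i _; rewrite -expr2 sqr_ge0. Qed.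

Lemma dotp_eq0 u : dotp u u = 0 -> u = 0.
Proof.
move/eqP; rewrite psumr_eq0 => [/allP H|i _]; last by rewrite -expr2 sqr_ge0.
apply/rowP => i; rewrite mxE; apply/eqP; have := H i.
by rewrite mem_index_enum mulf_eq0 orbb => /(_ isT).
Qed.

Lemma enorm_ge0 u : 0 <= enorm u. Proof. exact: sqrtr_ge0. Qed.

Lemma sqr_enorm u : enorm u ^+ 2 = dotp u u.
Proof. by rewrite sqr_sqrtr// dotp_ge0. Qed.

Lemma coord_le_enorm u i : `|u 0 i| <= enorm u.
Proof.
rewrite -sqrtr_sqr ler_wsqrtr// /dotp (bigD1 i)//= -expr2 lerDl.
by apply: sumr_ge0 => j _; rewrite -expr2 sqr_ge0.
Qed.

Lemma enorm_le_sum u : enorm u <= \sum_i `|u 0 i|.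
Proof.
rewrite -(ler_pXn2r (ltn0Sn 1)) ?nnegrE ?enorm_ge0 ?sumr_ge0//.
rewrite sqr_enorm /dotp expr2 mulr_sumr; apply: ler_sum => i _.
rewrite -[u 0 i * u 0 i]ger0_norm -?expr2 ?sqr_ge0// normrX expr2 ler_wpM2r//.
by rewrite (bigD1 i)//= lerDl sumr_ge0.
Qed.

Lemma enorm_le_bound u b : (forall i, `|u 0 i| <= b) -> enorm u <= m%:R * b.
Proof.
move=> H; rewrite (le_trans (enorm_le_sum u))//.
have -> : m%:R * b = \sum_(i < m) b by rewrite sumr_const card_ord mulr_natl.
exact: ler_sum.
Qed.

Lemma dotp_le_enorm u v : dotp u v <= enorm u * enorm v.
Proof.
have [v0|v0] := eqVneq (dotp v v) 0.
  by rewrite (dotp_eq0 v0) dotpC dotp0l mulr_ge0 ?enorm_ge0.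
have vp : 0 < dotp v v by rewrite lt0r v0 dotp_ge0.
rewrite (le_trans (ler_norm _))//.
rewrite -(ler_pXn2r (ltn0Sn 1)) ?nnegrE ?mulr_ge0 ?enorm_ge0// exprMn !sqr_enorm.
rewrite real_normK ?num_real//.
(* u - t v is the component of u orthogonal to v. *)
pose t := dotp u v / dotp v v.
have := dotp_ge0 (u - t *: v).
have -> : dotp (u - t *: v) (u - t *: v) = dotp u u - t * dotp u v.
  rewrite -scaleNr dotpDl dotpZl [dotp u _]dotpC [dotp v _]dotpC !dotpDl !dotpZl.
  by rewrite [dotp v u]dotpC /t; field.
by rewrite subr_ge0 /t mulrAC -expr2 ler_pdivrMr.
Qed.

Lemma dotp_cvg (T : Type) (F : set_system T) {FF : Filter F}
    (f g : T -> 'rV[R]_m) a b :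
  f @ F --> a -> g @ F --> b -> (fun k => dotp (f k) (g k)) @ F --> dotp a b.
Proof.
move=> fa gb; apply: cvg_big => [|i _]; first exact: add_continuous.
apply: cvgM.
  exact: (@cvg_comp _ _ _ f (fun x : 'rV[R]_m => x 0 i) _ _ _ fa (@coord_continuous _ _ _ _ _ _)).
exact: (@cvg_comp _ _ _ g (fun x : 'rV[R]_m => x 0 i) _ _ _ gb (@coord_continuous _ _ _ _ _ _)).
Qed.

End Dot.

(** * Subspaces as orthogonal projections *)

Section Projections.
Variables (R : realType) (m : nat).
Implicit Types (A P : 'M[R]_m) (v : 'rV[R]_m).

(** Subspaces are represented by their orthogonal projections acting on the right: these
have bounded entries, so that compactness of the Grassmannian reduces to that of a
cube, and the gap to the difference of two matrices. *)
Definition is_projection P := P^T = P /\ P *m P = P.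

(** If c B B^T = 0 then |c B|^2 = 0. *)
Lemma row_free_gram r (B : 'M[R]_(r, m)) : row_free B -> B *m B^T \in unitmx.
Proof.
move=> fB; rewrite -row_free_unit; apply: inj_row_free => c cG.
have /dotp_eq0 cB : dotp (c *m B) (c *m B) = 0.
  by rewrite dotpE trmx_mul mulmxA -(mulmxA c) cG mul0mx mxE.
exact: (row_free_inj fB) (etrans cB (esym (mul0mx _ _))).
Qed.

(** For a matrix B whose rows are a basis of the row space of A, the projection is
B^T (B B^T)^-1 B. *)
Lemma projection_exists A :
  exists2 P, is_projection P & forall v, (v <= A)%MS <-> v *m P = v.
Proof.
move: (row_base_free A) (eq_row_base A); move: (row_base A) => B fB eB.
have GU := row_free_gram fB; set G := B *m B^T in GU.
have GT : G^T = G by rewrite /G trmx_mul trmxK.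
exists (B^T *m invmx G *m B); first split.
- by rewrite trmx_mul trmx_mul trmxK trmx_inv GT mulmxA.
- by rewrite !mulmxA -(mulmxA _ B B^T) -/G -(mulmxA _ _ G) mulVmx// mulmx1.
move=> v; rewrite -eB; split.
  move=> /submxP[c ->].
  by rewrite !mulmxA -(mulmxA c) -/G -(mulmxA c) mulmxV// mulmx1.
by move=> <-; rewrite mulmxA submxMl.
Qed.

(** The diagonal entry P i i is the square norm of the row i, hence at least its own
square; so it is at most 1 and it bounds the squares of the entries of the row. *)
Lemma projection_entry_le1 P i j : is_projection P -> `|P i j| <= 1.
Proof.
move=> [PT PP].
have E : P i i = \sum_k P i k ^+ 2.
  rewrite -[in LHS]PP mxE; apply: eq_bigr => k _.
  by rewrite expr2 -[in X in _ * X]PT mxE.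
have Hk k : P i k ^+ 2 <= P i i.
  by rewrite E (bigD1 k)//= lerDl sumr_ge0// => l _; exact: sqr_ge0.
have P1 : P i i <= 1.
  have := Hk i; have [//|P1] := leP (P i i) 1.
  by rewrite expr2 ger_pMl ?(lt_trans ltr01)// leNgt P1.
by rewrite -(ler_pXn2r (ltn0Sn 1)) ?nnegrE// expr1n real_normK ?num_real// (le_trans (Hk j)).
Qed.

(** The condition s k >= k, weaker than monotonicity, makes u \o s converge to the
limits of u. *)
Lemma bolzano_weierstrass n (u : nat -> 'rV[R]_n) :
  (forall k, `|u k| <= 1) -> exists x (s : nat -> nat),
    (forall k, (k <= s k)%N) /\ forall k, `|u (s k) - x| < k.+1%:R^-1.
Proof.
move=> u1; have cK := @closed_ball_compact R n 0 1.
have [|x [_ cx]] := cK (u @ \oo) _.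
  by exists 0%N => // k _ /=; rewrite subr0.
have H k : exists j, (k <= j)%N /\ `|u j - x| < k.+1%:R^-1.
  have [||y [[j kj <-] /ballE jx]] := cx [set u j | j in [set j | (k <= j)%N]]
    (ball x k.+1%:R^-1) _ _.
  - by exists k => // j kj; exists j.
  - by apply: nbhsx_ballx; rewrite invr_gt0.
  - by exists j.
exists x, (fun k => sval (cid (H k))).
by split => k; have [] := svalP (cid (H k)).
Qed.

Lemma projection_subsequence (P : nat -> 'M[R]_m) :
  (forall k, is_projection (P k)) -> exists Q (s : nat -> nat),
    [/\ is_projection Q, forall k, (k <= s k)%N &
      forall k i j, `|P (s k) i j - Q i j| < k.+1%:R^-1].
Proof.
move=> HP; have [|x [s [sk Hs]]] := @bolzano_weierstrass _ (fun k => mxvec (P k)).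
  move=> k; apply: rV_norm_le => // ij.
  by case/mxvec_indexP: ij => i j; rewrite mxvecE projection_entry_le1.
pose Q : 'M[R]_m := vec_mx x.
have Hij k i j : `|P (s k) i j - Q i j| < k.+1%:R^-1.
  apply: le_lt_trans (Hs k).
  have -> : P (s k) i j - Q i j = (mxvec (P (s k)) - x) 0 (mxvec_index i j).
    by rewrite [RHS]mxE [in RHS]mxE mxvecE /Q mxE.
  exact: rV_coord_le.
exists Q, s; split => //.
have cij i j : (fun k => P (s k) i j) @ \oo --> Q i j.
  apply/cvgrPdist_lt => e e0; near=> k; rewrite distrC.
  apply: (lt_trans (Hij k i j)); near: k; exact: near_infty_natSinv_lt (PosNum e0).
split; apply/matrixP => i j.
  have := cij j i; have -> : (fun k => P (s k) j i) = (fun k => P (s k) i j).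
    by apply/funext => k; rewrite -[in LHS](HP (s k)).1 mxE.
  move=> c; rewrite mxE; exact: (cvg_unique _ c (cij i j)).
have c : (fun k => P (s k) i j) @ \oo --> (Q *m Q) i j.
  have -> : (fun k => P (s k) i j) = (fun k => \sum_l P (s k) i l * P (s k) l j).
    by apply/funext => k; rewrite -[in LHS](HP (s k)).2 mxE.
  rewrite mxE; apply: cvg_big => [|l _]; first exact: add_continuous.
  exact: cvgM.
exact: (cvg_unique _ c (cij i j)).
Unshelve. all: by end_near. Qed.

End Projections.

(** * The gap between subspaces *)

Section Gap.
Variables (R : realType) (m : nat).
Implicit Types (P Q : 'M[R]_m) (V W : set 'rV[R]_m).

Lemma sup_itv (A : set R) (b : R) : 0 <= b -> (forall x, A x -> 0 <= x <= b) ->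
  0 <= sup A <= b.
Proof.
move=> b0 H; have [->|/set0P[x Ax]] := eqVneq A set0; first by rewrite sup0 lexx.
have hs : has_sup A by split; [exists x|exists b => y /H/andP[]].
apply/andP; split.
  have /andP[x0 _] := H x Ax; apply: (le_trans x0); exact: sup_upper_bound.
by apply: ge_sup; [exists x|move=> y /H/andP[]].
Qed.

(** Any point w of W bounds the infimum. *)
Lemma dist_to_itv (v w : 'rV[R]_m) W : W w -> 0 <= dist_to v W <= enorm (v - w).
Proof.
move=> Ww.
have lb0 : lbound [set enorm (v - w) | w in W] 0 by move=> _ [w' _ <-]; exact: enorm_ge0.
apply/andP; split; first by apply: lb_le_inf => //; exists (enorm (v - w)); exists w.
by apply: ge_inf; [exists 0|exists w].
Qed.

(** The range of P, when P is a projection. *)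
Definition fix_set P : set 'rV[R]_m := [set v | v *m P = v].

(** A unit vector v = v P of the first space is at distance at most |v (P - Q)| from
v Q, which is in the second one. *)
Lemma half_gap P Q (e : R) : is_projection Q -> 0 <= e ->
  (forall i j, `|P i j - Q i j| <= e) ->
  0 <= sup [set dist_to v (fix_set Q) | v in [set v | fix_set P v /\ enorm v = 1]]
    <= m%:R * (m%:R * e).
Proof.
move=> [_ QQ] e0 PQ; apply: sup_itv; first by rewrite !mulr_ge0.
move=> _ [v [vP v1] <-].
have /andP[-> /le_trans H] : 0 <= dist_to v (fix_set Q) <= enorm (v - v *m Q).
  by apply: dist_to_itv; rewrite /fix_set /= -mulmxA QQ.
apply: H; apply: enorm_le_bound => j.
rewrite -[in X in X - _]vP -mulmxBr mxE (le_trans (ler_norm_sum _ _ _))//.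
have -> : m%:R * e = \sum_(i < m) e by rewrite sumr_const card_ord mulr_natl.
apply: ler_sum => i _; rewrite normrM -[leRHS]mul1r; apply: ler_pM => //.
  by rewrite -v1 coord_le_enorm.
by rewrite !mxE PQ.
Qed.

Lemma gap_projections P Q (e : R) : is_projection P -> is_projection Q ->
  0 <= e -> (forall i j, `|P i j - Q i j| <= e) ->
  `|gap (fix_set P) (fix_set Q)| <= m%:R * (m%:R * e).
Proof.
move=> HP HQ e0 PQ; have /andP[a0 ab] := half_gap HQ e0 PQ.
have /andP[c0 cb] : 0 <= sup [set dist_to v (fix_set P) | v in
    [set v | fix_set Q v /\ enorm v = 1]] <= m%:R * (m%:R * e).
  by apply: half_gap => // i j; rewrite distrC.
by rewrite /gap ger0_norm ?le_max ?a0// ge_max ab cb.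
Qed.

Lemma projection_vspace Q : is_projection Q ->
  exists T : {vspace 'rV[R]_m}, [set` T] = fix_set Q.
Proof.
move=> [_ QQ]; exists (limg (linfun (mulmxr Q : 'rV[R]_m -> 'rV[R]_m))).
apply/seteqP; split => v /=.
  by move=> /memv_imgP[w _ ->]; rewrite lfunE/= /fix_set /= -mulmxA QQ.
move=> vQ; have -> : v = linfun (mulmxr Q : 'rV[R]_m -> 'rV[R]_m) v by rewrite lfunE/= vQ.
exact/memv_img/memvf.
Qed.

End Gap.

(** * Tangent spaces in charts *)

Section Tangent.
Variables (R : realType) (m : nat).
Local Notation E := 'rV[R]_m.

(** Straightening data as in the definition of submanifolds, with the base point left
out, because tangent spaces are compared at all points of one chart. *)
Definition chart (p d : nat) (M : set E) (U W : set E) (phi psi : E -> E) : Prop :=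
  [/\ open U, open W &
    [/\ forall y, U y -> W (phi y) /\ psi (phi y) = y,
        forall z, W z -> U (psi z) /\ phi (psi z) = z,
        Ck_on p U phi & Ck_on p W psi] /\
    forall y, U y -> (M y <-> forall j : 'I_m, (d <= j)%N -> phi y 0 j = 0)].

(** The d-dimensional coordinate subspace to which a chart sends the submanifold. *)
Definition model (d : nat) (w : E) : Prop := forall j : 'I_m, (d <= j)%N -> w 0 j = 0.

Lemma Ck_on_shift (V W : normedModType R) k (U : set V) (f : V -> W) a :
  Ck_on k U f -> Ck_on k [set x | U (a + x)] (fun x => f (a + x)).
Proof.
elim: k f => [|k IH] f.
  move=> Cf x Ux; apply: continuous_comp; last exact: Cf.
  by apply: continuous_add_at; first exact: cst_continuous.
move=> [df Df]; split=> [x Ux|v].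
  apply: (@differentiable_comp _ _ _ _ (fun x => a + x) f); last exact: df.
  exact: differentiableD.
have E' : (fun x => 'D_v (fun x => f (a + x)) x) = (fun x => 'D_v f (a + x)).
  apply/funext => x; rewrite /derive /=.
  suff -> : (fun h => h^-1 *: (f (a + (h *: v + x)) - f (a + x))) =
          (fun h => h^-1 *: (f (h *: v + (a + x)) - f (a + x))) by [].
  by apply/funext => h; rewrite addrCA.
by rewrite E'; apply: IH (Df v).
Qed.

(** The curve is the image by psi of a segment with direction w. *)
Lemma tangent_of_model p d (M U W : set E) phi psi y w : (1 <= p)%N ->
  chart p d M U W phi psi -> U y -> M y -> model d w ->
  tangent M y ('D_w psi (phi y)).
Proof.
move=> p1 [oU oW [[HU HW Cphi Cpsi] HM]] Uy My mw.
have [Wy psiy] := HU y Uy.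
pose L (t : R) := t *: w.
have Llin : linear L by move=> a s t; rewrite /L scalerDl scalerA.
pose HL := GRing.isLinear.Build R _ _ _ L Llin.
pose LL : {linear R -> E} := HB.pack L HL.
have cL : continuous LL.
  by move=> t; apply: (@continuous_scalel_at _ _ _ (fun s : R => s)).
pose g (t : R) := psi (phi y + t *: w).
have Cg : Ck_on 1 [set t : R | W (phi y + t *: w)] g.
  exact: (Ck_on_lin_pre cL (Ck_on_shift (phi y) (Ck_on_le p1 Cpsi))).
have oD : open [set t : R | W (phi y + t *: w)].
  apply: (@open_comp _ _ (fun t : R => phi y + t *: w)) oW => t _.
  have c1 : {for t, continuous (cst (phi y) : R -> E)} by exact: cst_continuous.
  exact: (continuous_add_at c1 (cL t)).
have D0 : [set t : R | W (phi y + t *: w)] 0 by rewrite /= scale0r addr0.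
have /nbhs_ballP[e e0 He] := open_nbhs_nbhs (conj oD D0).
have He' (t : R) : `|t| < e -> W (phi y + t *: w).
  by move=> te; apply: He; apply/ballE; rewrite subr0.
exists g.
  exists e => //; split.
  - by apply: Ck_on_sub Cg => t /= te; exact: He'.
  - move=> t /He' Wt; have [Ut phit] := HW _ Wt; apply/(HM _ Ut).2 => j dj.
    rewrite phit !mxE mw// mulr0 addr0.
    exact: (HM _ Uy).1.
  - by rewrite /g scale0r addr0.
have dpsi : differentiable psi (phi y + 0 *: w).
  by rewrite scale0r addr0; exact: (Ck_on_le p1 Cpsi).1.
have dl : differentiable (fun t : R => phi y + t *: w) 0.
  by apply: differentiableD => //; apply: differentiableZl.
rewrite derive1E (@derive_comp _ _ _ _ (fun t : R => phi y + t *: w) psi 0 1 dl dpsi).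
rewrite (@deriveD _ _ _ (cst (phi y)) (fun t : R => t *: w))//; last first.
  by apply: diff_derivable; apply: differentiableZl.
by rewrite derive_cst add0r deriveZl// derive_id scale1r scale0r addr0.
Qed.

(** For a curve g of M the curve phi \o g stays in the coordinate subspace, hence so
does its velocity w, and psi sends it back to the velocity of g. *)
Lemma model_of_tangent p d (M U W : set E) phi psi y v : (1 <= p)%N ->
  chart p d M U W phi psi -> U y -> tangent M y v ->
  exists2 w, model d w & v = 'D_w psi (phi y).
Proof.
move=> p1 [oU oW [[HU HW Cphi Cpsi] HM]] Uy [g [e e0 [Cg Mg g0]] <-].
have dg : differentiable g 0 by apply: Cg.1; rewrite /= normr0.
have dphi : differentiable phi (g 0) by rewrite g0; exact: (Ck_on_le p1 Cphi).1.
have [Wy psiy] := HU y Uy.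
have dpsi : differentiable psi (phi (g 0)) by rewrite g0; exact: (Ck_on_le p1 Cpsi).1.
have dpg : differentiable (phi \o g) 0 by exact: differentiable_comp.
have nU : \forall t \near (0 : R), U (g t).
  have : nbhs (g 0) U by rewrite g0; exact: open_nbhs_nbhs.
  exact: (differentiable_continuous dg).
have nM : \forall t \near (0 : R), M (g t).
  by apply/nbhs_ballP; exists e => // t /ballE; rewrite subr0 => /Mg.
exists ('D_1 (phi \o g) 0).
  move=> j dj; rewrite derive_mx; last exact: diff_derivable.
  rewrite mxE (@near_eq_derive _ _ _ _ (cst 0)); first exact: derive_cst.
  by near=> t => /=; apply: (HM (g t) _).1 => //; near: t.
rewrite derive1E -g0 -(derive_comp _ dpg dpsi).
by apply: near_eq_derive; near=> t => /=; rewrite (HU (g t) _).2//; near: t.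
Unshelve. all: by end_near. Qed.

(** By the two previous lemmas the tangent set is the row space of the matrix of the
derivatives of psi along the first d axes. *)
Lemma tangent_projection p (M : set E) y : (1 <= p)%N -> submanifold p M -> M y ->
  exists2 P, is_projection P & tangent M y = fix_set P.
Proof.
move=> p1 [d dm H] My; have [U [W [phi [psi [[oU Uy oW] H2]]]]] := H y My.
have Hc : chart p d M U W phi psi by [].
have dpsi : differentiable psi (phi y).
  have [[HU _ _ Cpsi] _] := H2; apply: (Ck_on_le p1 Cpsi).1.
  by have [] := HU y Uy.
pose A : 'M[R]_m := \matrix_i (if (i < d)%N then 'D_(delta_mx 0 i) psi (phi y) else 0).
have DA w : model d w -> 'D_w psi (phi y) = w *m A.
  move=> mw; rewrite (derive_coord _ dpsi) mulmx_sum_row; apply: eq_bigr => i _.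
  by rewrite rowK; case: ltnP => // /mw ->; rewrite !scale0r.
have [P HP PA] := projection_exists A; exists P => //.
apply/seteqP; split => v.
  by move=> /(model_of_tangent p1 Hc Uy)[w mw ->]; apply/PA; rewrite DA// submxMl.
move=> /PA/submxP[w ->].
(* The rows of A of index at least d are zero, so the coefficients on them may be
   dropped. *)
pose w' : E := \row_i (if (i < d)%N then w 0 i else 0).
have mw' : model d w' by move=> j dj; rewrite mxE ltnNge dj.
have -> : w *m A = 'D_w' psi (phi y).
  rewrite DA// !mulmx_sum_row; apply: eq_bigr => i _.
  by rewrite rowK mxE; case: ltnP => //; rewrite !scaler0.
exact: tangent_of_model Hc Uy My mw'.
Qed.

End Tangent.

(** * Limits of normal vectors *)

Lemma finite_set_enum (I : Type) (A : set I) : finite_set A ->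
  exists n (e : nat -> option I), forall i, A i -> exists2 r, (r < n)%N & e r = Some i.
Proof.
move=> /finite_set_leP[n /card_leP[f]].
pose e (r : nat) : option I :=
  if pselect (exists i : A, val (f i) = r) is left H then Some (val (sval (cid H)))
  else None.
exists n, e => i Ai; pose i0 : A := exist _ i (mem_set Ai).
exists (val (f i0)); first exact: (set_mem (valP (f i0))).
rewrite /e; case: pselect => [H|[]]; last by exists i0.
congr Some; have /val_inj fj := svalP (cid H).
have -> : sval (cid H) = i0 by apply: (@inj _ _ [set: A] f) => //; rewrite inE.
by [].
Qed.

Lemma finite_pigeonhole (I : Type) (A : set I) (P : I -> nat -> Prop) :
  finite_set A -> (\forall k \near \oo, exists2 i, A i & P i k) ->
  exists i, forall N, exists2 k, (N <= k)%N & P i k.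
Proof.
move=> /finite_set_enum[n [e He]] HP; apply: contrapT => H.
have H1 (r : 'I_n) : \forall k \near \oo, forall i, e r = Some i -> ~ P i k.
  case er : (e r) => [i|]; last by apply: nearW.
  have /existsNP[N HN] : ~ forall N, exists2 k, (N <= k)%N & P i k.
    by move=> Hi; apply: H; exists i.
  exists N => // k Nk j [<-] Pk; apply: HN; by exists k.
have H2 : \forall k \near \oo, forall (r : 'I_n) i, e r = Some i -> ~ P i k.
  exact: filter_forall.
near \oo => k.
have [i Ai Pk] : exists2 i, A i & P i k by near: k.
have [r rn er] := He i Ai.
suff : forall (r : 'I_n) i, e r = Some i -> ~ P i k by move=> /(_ (Ordinal rn) i er).
by near: k.
Unshelve. all: by end_near. Qed.

Lemma subsequence_cvg (T : topologicalType) (u : nat -> T) (s : nat -> nat) (l : T) :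
  (forall k, (k <= s k)%N) -> u @ \oo --> l -> (u \o s) @ \oo --> l.
Proof.
move=> sk ul; apply: cvg_comp ul => A [N _ NA]; exists N => // k /= Nk.
by apply: NA; exact: leq_trans Nk (sk k).
Qed.

Section NormalLimit.
Variables (R : realType) (m : nat).
Local Notation E := 'rV[R]_m.

(** A tangent vector at the limit is 'D_w psi (phi x) for some w, and it is the limit
of the tangent vectors 'D_w psi (phi (u k)). *)
Lemma normal_limit_same p (M : set E) (x nuL : E) (u nu : nat -> E) :
  (1 <= p)%N -> submanifold p M -> M x -> (forall k, M (u k)) ->
  u @ \oo --> x -> nu @ \oo --> nuL ->
  (forall k v, tangent M (u k) v -> dotp (nu k) v = 0) ->
  forall v, tangent M x v -> dotp nuL v = 0.
Proof.
move=> p1 [d dm H] Mx Mu ux nuc Hnu v.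
have [U [W [phi [psi [[oU Ux oW] H2]]]]] := H x Mx.
have Hc : chart p d M U W phi psi by [].
move=> /(model_of_tangent p1 Hc Ux)[w mw ->].
have [[HU HW Cphi Cpsi] _] := H2.
have nU : nbhs x U by exact: open_nbhs_nbhs.
have uU : \forall k \near \oo, U (u k) by exact: ux nU.
have [Wx _] := HU x Ux.
have c1 : (fun k => phi (u k)) @ \oo --> phi x.
  exact: (cvg_comp _ _ ux (differentiable_continuous ((Ck_on_le p1 Cphi).1 x Ux))).
have c2 : (fun k => 'D_w psi (phi (u k))) @ \oo --> 'D_w psi (phi x).
  exact: (cvg_comp _ _ c1 ((Ck_on_le p1 Cpsi).2 w _ Wx)).
have c3 : (fun k => dotp (nu k) ('D_w psi (phi (u k)))) @ \oo -->
  dotp nuL ('D_w psi (phi x)) by exact: dotp_cvg.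
apply/esym; apply: (cvg_unique _ _ c3) => //.
apply: (@cvg_trans _ (cst (0 : R) @ \oo)); last exact: cvg_cst.
apply: near_eq_cvg; near=> k; rewrite /= Hnu//.
by apply: (tangent_of_model p1 Hc _ (Mu k) mw); near: k.
Unshelve. all: by end_near. Qed.

(** Along a subsequence the projections onto the tangent spaces of S i converge to
a projection Q; this is convergence in the gap, so property (a) places the tangent
space of S j in the range of Q.  A vector v = v Q of it is the limit of the tangent
vectors v P_k. *)
Lemma normal_limit_whitney p (I : Type) (S : I -> set E) i j (x nuL : E)
    (u nu : nat -> E) :
  (1 <= p)%N -> (forall i, submanifold p (S i)) -> whitney_a S -> i <> j ->
  S j x -> (forall k, S i (u k)) ->
  u @ \oo --> x -> nu @ \oo --> nuL ->
  (forall k v, tangent (S i) (u k) v -> dotp (nu k) v = 0) ->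
  forall v, tangent (S j) x v -> dotp nuL v = 0.
Proof.
move=> p1 HS Wa ij Sx Su ux nuc Hnu v Tv.
have HP k : exists P, is_projection P /\ tangent (S i) (u k) = fix_set P.
  by have [P ? ?] := tangent_projection p1 (HS i) (Su k); exists P.
pose P k := sval (cid (HP k)).
have PP k : is_projection (P k) by exact: (svalP (cid (HP k))).1.
have PT k : tangent (S i) (u k) = fix_set (P k) by exact: (svalP (cid (HP k))).2.
have [Q [s [HQ sk PQ]]] := projection_subsequence PP.
have [T TQ] := projection_vspace HQ.
have us := subsequence_cvg sk ux.
have nus := subsequence_cvg sk nuc.
have gap0 : (fun k => gap (tangent (S i) ((u \o s) k)) [set` T]) @ \oo --> (0 : R).
  rewrite TQ; apply/cvgrPdist_le => e e0.
  have e'0 : 0 < e / (m%:R * m%:R + 1) :> R by rewrite divr_gt0// ltr_wpDl// mulr_ge0.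
  near=> k; rewrite sub0r normrN /= PT.
  apply: (@le_trans _ _ (m%:R * (m%:R * (e / (m%:R * m%:R + 1))))).
    apply: gap_projections => //; first exact: ltW.
    move=> a b; apply/ltW; apply: (lt_trans (PQ k a b)).
    near: k; exact: near_infty_natSinv_lt (PosNum e'0).
  have -> : m%:R * (m%:R * (e / (m%:R * m%:R + 1))) =
    e * (m%:R * m%:R / (m%:R * m%:R + 1)) :> R by ring.
  by rewrite ger_pMr// ler_pdivrMr ?mul1r ?lerDl// ltr_wpDl// mulr_ge0.
have clx : (closure (S i) `&` S j) x.
  split => // B nB; have [N _ NB] := ux B nB.
  by exists (u N); split; [exact: Su|by apply: NB => /=].
have := Wa i j ij x clx (u \o s) T (fun k => Su (s k)) us gap0 v Tv.
rewrite TQ /fix_set /= => vQ.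
have c1 : (fun k => v *m P (s k)) @ \oo --> v *m Q.
  apply/cvgrPdist_le => e e0.
  have e'0 : 0 < e / (m%:R * `|v| + 1) :> R by rewrite divr_gt0// ltr_wpDl// mulr_ge0.
  near=> k.
  rewrite -mulmxBr; apply: rV_norm_le => [|b]; first exact: ltW.
  rewrite mxE (le_trans (ler_norm_sum _ _ _))//.
  apply: (@le_trans _ _ (\sum_(a < m) (`|v| * (e / (m%:R * `|v| + 1))))).
    apply: ler_sum => a _; rewrite normrM ler_pM ?rV_coord_le//.
    rewrite !mxE distrC; apply/ltW; apply: (lt_trans (PQ k a b)).
    near: k; exact: near_infty_natSinv_lt (PosNum e'0).
  rewrite sumr_const card_ord -[leLHS]mulr_natl.
  have -> : m%:R * (`|v| * (e / (m%:R * `|v| + 1))) =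
    e * (m%:R * `|v| / (m%:R * `|v| + 1)) :> R by ring.
  by rewrite ger_pMr// ler_pdivrMr ?mul1r ?lerDl// ltr_wpDl// mulr_ge0.
have c2 : (fun k => dotp ((nu \o s) k) (v *m P (s k))) @ \oo -->
  dotp nuL (v *m Q) by exact: dotp_cvg.
rewrite -[v in LHS]vQ; apply/esym; apply: (cvg_unique _ _ c2) => //.
have -> : (fun k => dotp ((nu \o s) k) (v *m P (s k))) = cst 0; last exact: cvg_cst.
apply/funext => k /=; apply: Hnu; rewrite PT /fix_set /= -mulmxA.
by rewrite (PP (s k)).2.
Unshelve. all: by end_near. Qed.

(** Since only finitely many strata meet a neighbourhood of x, one of them contains
u k for infinitely many k, and one of the two previous lemmas applies along these
indices. *)
Lemma normal_limit p (X : set E) (I : Type) (S : I -> set E) j (x nuL : E)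
    (u nu : nat -> E) :
  (1 <= p)%N -> whitney_stratification p X S ->
  S j x -> (forall k, X (u k)) -> u @ \oo --> x -> nu @ \oo --> nuL ->
  (forall k i, S i (u k) -> forall v, tangent (S i) (u k) v -> dotp (nu k) v = 0) ->
  forall v, tangent (S j) x v -> dotp nuL v = 0.
Proof.
move=> p1 [[[covS _ _] locf HS _] Wa] Sx Xu ux nuc Hnu.
have Xx : X x by rewrite -covS; exists j.
have [N nN finN] := locf x Xx.
have [i Hi] : exists i, forall K, exists2 k, (K <= k)%N & S i (u k).
  apply: (finite_pigeonhole finN).
  have : \forall k \near \oo, N (u k) by exact: ux nN.
  apply: filterS => k Nk; have := Xu k; rewrite -covS => -[i _ Si].
  by exists i => //; exists (u k).
pose s K := s2val (cid2 (Hi K)).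
have sk K : (K <= s K)%N by exact: s2valP (cid2 (Hi K)).
have Ss K : S i (u (s K)) by exact: s2valP' (cid2 (Hi K)).
have us := subsequence_cvg sk ux.
have nus := subsequence_cvg sk nuc.
have Hs K v : tangent (S i) (u (s K)) v -> dotp (nu (s K)) v = 0.
  by apply: Hnu; exact: Ss.
have [ij|ij] := pselect (i = j).
  by subst j; exact: normal_limit_same (HS i) Sx Ss us nus Hs.
exact: (normal_limit_whitney p1 HS Wa ij Sx Ss us nus Hs).
Qed.

End NormalLimit.

(** * Frechet subgradients and tangent curves of the graph *)

Section Graph.
Variables (R : realType) (n : nat).
Implicit Types (x y : 'rV[R]_n) (w : 'rV[R]_(n + 1)).

(** The last coordinate, equal to f on the graph of f. *)
Definition height w : R := w 0 (rshift n 0).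

Lemma height_is_linear : linear height.
Proof. by move=> a u v; rewrite /height !mxE. Qed.
HB.instance Definition _ := GRing.isLinear.Build R _ _ _ height height_is_linear.

Definition base_pt x : 'rV[R]_(n + 1) := pt x 0.

Lemma base_pt_is_linear : linear base_pt.
Proof.
move=> a u v; apply/rowP => i; rewrite !mxE; case: split_ordP => j _.
  by rewrite !mxE.
by rewrite !mxE mul0rn mulr0 addr0.
Qed.
HB.instance Definition _ := GRing.isLinear.Build R _ _ _ base_pt base_pt_is_linear.

Lemma ptE x t : pt x t = base_pt x + t *: vertical R n.
Proof.
apply/rowP => i; rewrite !mxE; case: split_ordP => j _; rewrite !mxE.
  by rewrite mulr0 addr0.
by rewrite ord1 eqxx !mulr1n add0r mulr1.
Qed.

Lemma Pi_pt x t : Pi (pt x t) = x. Proof. exact: row_mxKl. Qed.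

Lemma height_pt x t : height (pt x t) = t.
Proof. by rewrite /height row_mxEr mxE eqxx mulr1n. Qed.

Lemma dotp_pt x t w : dotp (pt x t) w = dotp x (Pi w) + t * height w.
Proof.
rewrite /dotp big_split_ord /= big_ord1; congr (_ + _).
  by apply: eq_bigr => i _; rewrite row_mxEl !mxE.
by rewrite row_mxEr mxE eqxx mulr1n.
Qed.

Lemma pt_cvg (u : nat -> 'rV[R]_n) (t : nat -> R) x a :
  u @ \oo --> x -> t @ \oo --> a -> (fun k => pt (u k) (t k)) @ \oo --> pt x a.
Proof.
move=> ux ta; rewrite ptE.
have -> : (fun k => pt (u k) (t k)) = (fun k => base_pt (u k) + t k *: vertical R n).
  by apply/funext => k; rewrite ptE.
apply: cvgD; last exact: cvgZr_tmp.
have cb : continuous base_pt by exact: rV_linear_continuous.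
exact: (cvg_comp _ _ ux (cb x)).
Qed.

Lemma Pi_coord_le w i : `|Pi w 0 i| <= `|w|.
Proof. by rewrite mxE rV_coord_le. Qed.

Variables (f : 'rV[R]_n -> \bar R) (hf : forall x, f x != -oo%E).

Lemma dom_fin x : dom f x -> f x = (fine (f x))%:E.
Proof.
by move=> dx; rewrite fineK// fin_numE hf /=; move: dx; rewrite /dom /= ltey.
Qed.

Lemma graph_height u : graph f u -> f (Pi u) = (height u)%:E /\ u = graph_pt f (Pi u).
Proof.
move=> [y dy <-]; rewrite /graph_pt Pi_pt height_pt; split => //.
exact: dom_fin.
Qed.

(** The lower limit condition without extended reals.  The case y = x is included,
so that the bound also applies along a curve that returns to x. *)
Lemma frechet_lower_bound x p a : frechet_subdiff f x p -> f x = a%:E ->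
  forall e : R, 0 < e -> \forall y \near x, forall b, f y = b%:E ->
    - e * enorm (y - x) <= b - a - dotp p (y - x).
Proof.
move=> [_]; rewrite limf_einfE => H fa e e0.
set G := (fun y => _) in H.
have : ((- e)%:E < ereal_sup [set ereal_inf (G @` V) | V in x^'])%E.
  by apply: lt_le_trans H; rewrite lte_fin oppr_lt0.
move=> /ereal_sup_gt[_ [V nV <-] HV].
have : \forall y \near x, y != x -> V y by exact: nV.
apply: filterS => y Vy b fb.
have [yx|yx] := eqVneq y x.
  move: fb; rewrite yx fa => -[->].
  by rewrite !subrr /enorm dotp0l dotpC dotp0l sqrtr0 mulr0 subr0.
have d0 : 0 < enorm (y - x).
  rewrite lt0r enorm_ge0 andbT; apply/eqP => d0; move/eqP: yx; apply.
  by apply/eqP; rewrite -subr_eq0; apply/eqP/dotp_eq0; rewrite -sqr_enorm d0 expr0n.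
have : ((- e)%:E < G y)%E.
  by apply: (lt_le_trans HV); apply: ereal_inf_lbound; exists y => //; exact: Vy.
by rewrite /G fb fa -!EFinB -EFinM lte_fin ltr_pdivlMr// => /ltW.
Qed.

(** The lower bound for t and for -t makes both signs of the derivative impossible. *)
Lemma zero_derivative (h : R -> R) : differentiable h 0 ->
  (forall e : R, 0 < e -> \forall t \near 0, - (e * `|t|) <= h t - h 0) ->
  'D_1 h 0 = 0.
Proof.
move=> dh H; set D := 'D_1 h 0; apply/eqP; rewrite -normr_le0 -[0]addr0.
apply/ler_addgt0Pr => e e0; rewrite addr0 add0r.
have e2 : 0 < e / 2 by rewrite divr_gt0.
have n1 := derive_expansion dh e2; have n2 := H _ e2.
have [r r0 Hr] := nbhs_ballI n1 n2.
have B t : `|t| < r -> - (e * `|t|) <= D * t.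
  move=> tr; have [|] := Hr t; first by apply/ballE; rewrite subr0.
  have -> : 'D_(t - 0) h 0 = D * t.
    rewrite subr0 /D; have -> : t = t *: (1 : R) by rewrite /GRing.scale/= mulr1.
    by rewrite (derive_dirZ _ _ dh) /GRing.scale /= mulr1 mulrC.
  rewrite subr0 ler_norml => /andP[_ ?] ?; lra.
have s0 : 0 < r / 2 by rewrite divr_gt0.
have b1 := B (r / 2); have b2 := B (- (r / 2)).
rewrite normrN gtr0_norm// in b2; rewrite gtr0_norm// in b1.
have {}b1 := b1 ltac:(lra); have {}b2 := b2 ltac:(lra).
rewrite ler_norml; apply/andP; split; rewrite -(ler_pM2r s0); lra.
Qed.

(** Along a curve g of M, minus the function t |-> <(p, -1), g t> is f - <p, .>, so the
subgradient inequality bounds its decrease by o(t); its derivative is then zero. *)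
Lemma frechet_normal x p (M : set 'rV[R]_(n + 1)) : M `<=` graph f ->
  frechet_subdiff f x p ->
  forall w, tangent M (graph_pt f x) w -> dotp (pt p (-1)) w = 0.
Proof.
move=> MG Hp _ [g [e e0 [Cg Mg g0]] <-].
have dx : dom f x by case: Hp.
have fx := dom_fin dx; set a := fine (f x) in fx.
have dg : differentiable g 0 by apply: Cg.1; rewrite /= normr0.
pose l w := dotp w (pt p (-1)).
have llin : linear l by move=> c u v; rewrite /l dotpDl dotpZl.
pose HL := GRing.isLinear.Build R _ _ _ l llin.
pose L : {linear 'rV[R]_(n + 1) -> R} := HB.pack l HL.
have cL : continuous L by exact: rV_linear_continuous.
have dL := linear_differentiable (g 0) cL.
have dlg : differentiable (L \o g) 0 by exact: differentiable_comp.
rewrite derive1E dotpC.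
have DE : 'D_1 (L \o g) 0 = L ('D_1 g 0) by rewrite (derive_comp _ dg dL) derive_linear.
rewrite -[LHS]/(L ('D_1 g 0)) -DE.
apply: oppr_inj; rewrite oppr0.
have dN : differentiable (\- (L \o g)) 0 by exact: differentiableN.
rewrite -(@deriveN _ _ _ (L \o g)); last exact: diff_derivable.
apply: zero_derivative => // eps eps0.
(* Near 0 the projected curve moves by at most K |t|, in the Euclidean norm. *)
pose K := n%:R * (`|'D_1 g 0| + 1) + 1.
have K0 : 0 < K by rewrite ltr_wpDl// mulr_ge0// addr_ge0.
have eK : 0 < eps / K by rewrite divr_gt0.
have cPi : continuous (@Pi R n) by exact: rV_linear_continuous.
have nF : \forall t \near (0 : R), forall b, f (Pi (g t)) = b%:E ->
    - (eps / K) * enorm (Pi (g t) - x) <= b - a - dotp p (Pi (g t) - x).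
  have cg : {for 0, continuous (@Pi R n \o g)}.
    by apply: continuous_comp; [exact: differentiable_continuous|exact: cPi].
  have Pg0 : (@Pi R n \o g) 0 = x by rewrite /= g0 Pi_pt.
  have := frechet_lower_bound Hp fx eK; rewrite -Pg0; exact: cg.
have nM : \forall t \near (0 : R), M (g t).
  by apply/nbhs_ballP; exists e => // t /ballE; rewrite subr0 => /Mg.
have nL : \forall t \near (0 : R), `|g t - g 0| <= (`|'D_1 g 0| + 1) * `|t|.
  have := derive_expansion dg ltr01; apply: filterS => t.
  rewrite subr0 mul1r => H.
  have E : 'D_t g 0 = t *: 'D_1 g 0.
    have {1}-> : t = t *: (1 : R) by rewrite /GRing.scale/= mulr1.
    exact: derive_dirZ.
  rewrite -(subrK ('D_t g 0) (g t - g 0)) (le_trans (ler_normD _ _))//.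
  by rewrite mulrDl mul1r addrC lerD// E normrZ mulrC.
near=> t.
have Mt : M (g t) by near: t.
have [fg gE] := graph_height (MG _ Mt).
have H1 : - (eps / K) * enorm (Pi (g t) - x) <=
    height (g t) - a - dotp p (Pi (g t) - x).
  by apply: (near nF t).
have H2 : `|g t - g 0| <= (`|'D_1 g 0| + 1) * `|t| by near: t.
have H3 : enorm (Pi (g t) - x) <= K * `|t|.
  apply: (@le_trans _ _ (n%:R * ((`|'D_1 g 0| + 1) * `|t|))).
    apply: enorm_le_bound => i; apply: le_trans H2.
    have -> : Pi (g t) - x = Pi (g t - g 0) by rewrite /Pi linearB g0 /= row_mxKl.
    exact: Pi_coord_le.
  by rewrite mulrA ler_wpM2r// /K lerDl.
have H4 : eps / K * enorm (Pi (g t) - x) <= eps * `|t|.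
  have := ler_wpM2l (ltW eK) H3; rewrite mulrA divfK// gt_eqF//.
have E : height (g t) - a - dotp p (Pi (g t) - x) = - L (g t) - - L (g 0).
  rewrite /L /= /l [dotp (g t) _]dotpC [dotp (g 0) _]dotpC !dotp_pt.
  rewrite g0 /graph_pt Pi_pt height_pt -/a.
  rewrite [dotp p (_ - _)]dotpC dotpDl -(scaleN1r x) dotpZl [dotp (Pi _) p]dotpC.
  by rewrite [dotp x p]dotpC; ring.
rewrite /= -E; apply: le_trans H1; rewrite mulNr lerN2; exact: H4.
Unshelve. all: by end_near. Qed.

End Graph.

(** * Clarke subgradients and the Riemannian gradient *)

Section Clarke.
Variables (R : realType) (n p : nat) (f : 'rV[R]_n -> \bar R).
Variables (I : Type) (S : I -> set 'rV[R]_(n + 1)).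
Hypotheses (hp : (1 <= p)%N) (hf : forall x, f x != -oo%E).
Hypothesis (hS : whitney_stratification p (graph f) S).

Lemma stratum_sub_graph i : S i `<=` graph f.
Proof. by have [[[<- _ _] _ _ _] _] := hS => u Su; exists i. Qed.

Lemma graph_pt_cvg (u : nat -> 'rV[R]_n) x : dom f x -> u @ \oo --> x ->
  (fun k => f (u k)) @ \oo --> f x -> (fun k => graph_pt f (u k)) @ \oo --> graph_pt f x.
Proof.
move=> dx ux fu; apply: pt_cvg => //.
rewrite (dom_fin hf dx) in fu; exact: (fine_cvg fu).
Qed.

(** Limit of the normals (s_k, -1). *)
Lemma limiting_normal x i q w : S i (graph_pt f x) -> limiting_subdiff f x q ->
  tangent (S i) (graph_pt f x) w -> dotp (pt q (-1)) w = 0.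
Proof.
move=> Sx [dx [u [s [Hs ux fu sq]]]].
apply: (normal_limit hp hS Sx (u := fun k => graph_pt f (u k))
  (nu := fun k => pt (s k) (-1))).
- by move=> k; exists (u k) => //; case: (Hs k).
- exact: graph_pt_cvg.
- by apply: pt_cvg => //; exact: cvg_cst.
- by move=> k j _ v; apply: (frechet_normal hf (@stratum_sub_graph j) (Hs k)).
Qed.

(** Limit of the normals t_k (s_k, -1) = (t_k s_k, -t_k). *)
Lemma asymptotic_normal x i q w : S i (graph_pt f x) -> asymptotic_subdiff f x q ->
  tangent (S i) (graph_pt f x) w -> dotp (pt q 0) w = 0.
Proof.
move=> Sx [dx [u [s [t [Hs [t0 _ tc] ux fu sq]]]]].
apply: (normal_limit hp hS Sx (u := fun k => graph_pt f (u k))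
  (nu := fun k => pt (t k *: s k) (- t k))).
- by move=> k; exists (u k) => //; case: (Hs k).
- exact: graph_pt_cvg.
- by apply: pt_cvg => //; rewrite -oppr0; exact: cvgN.
- move=> k j _ v /(frechet_normal hf (@stratum_sub_graph j) (Hs k)).
  by rewrite !dotp_pt dotpZl => H; rewrite -[RHS](mulr0 (t k)) -H; ring.
Qed.

(** Adding the normals (q, -1) and (q', 0) gives the equation for q + q'; for fixed w it
is affine and closed in the subgradient, hence it passes to convex combinations and
to the closure. *)
Lemma clarke_normal x i xs w : S i (graph_pt f x) -> clarke_subdiff f x xs ->
  tangent (S i) (graph_pt f x) w -> dotp xs (Pi w) = height w.
Proof.
move=> Sx Hxs Tw.
have hull z : convex_hull [set a + b | a in limiting_subdiff f x &
    b in asymptotic_subdiff f x] z -> dotp z (Pi w) = height w.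
  move=> [k [a [u [_ a1 Hu ->]]]].
  have uw j : dotp (u j) (Pi w) = height w.
    have [q Hq [q' Hq' <-]] := Hu j.
    have := limiting_normal Sx Hq Tw; have := asymptotic_normal Sx Hq' Tw.
    rewrite !dotp_pt mul0r addr0 mulN1r dotpDl => -> /eqP.
    by rewrite subr_eq0 addr0 => /eqP.
  have -> : dotp (\sum_(j < k) a j *: u j) (Pi w) = \sum_(j < k) a j * dotp (u j) (Pi w).
    elim/big_ind2: _ => [|y c y' b <- <-|j _]; rewrite ?dotp0l ?dotpDl ?dotpZl//.
  under eq_bigr do rewrite uw.
  by rewrite -mulr_suml a1 mul1r.
pose l z := dotp z (Pi w).
have llin : linear l by move=> c u v; rewrite /l dotpDl dotpZl.
pose HL := GRing.isLinear.Build R _ _ _ l llin.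
pose L : {linear 'rV[R]_n -> R} := HB.pack l HL.
have cL : {for xs, continuous L} by exact: rV_linear_continuous.
have [lt|gt|//] := ltgtP (dotp xs (Pi w)) (height w).
  have [z [/hull Hz Lz]] := Hxs _ (continuous_at_lt cL lt).
  by move: Lz; rewrite /= /l Hz ltxx.
have [z [/hull Hz Lz]] := Hxs _ (continuous_at_gt cL gt).
by move: Lz; rewrite /= /l Hz ltxx.
Qed.

Lemma height_derive (k : R -> 'rV[R]_(n + 1)) i u : C1_curve (S i) u k ->
  derive1 (fun t : R => fine (f (Pi (k t)))) 0 = height (derive1 k 0).
Proof.
move=> [e e0 [Ck Mk k0]].
have dk : differentiable k 0 by apply: Ck.1; rewrite /= normr0.
have ch : continuous (@height R n) by exact: rV_linear_continuous.
have dh : differentiable (@height R n) (k 0) by exact: linear_differentiable.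
rewrite !derive1E -(derive_linear (k 0) _ ch) -(derive_comp _ dk dh).
apply: near_eq_derive; apply/nbhs_ballP; exists e => // t /ballE; rewrite subr0 => te.
by have [-> _] := graph_height hf (stratum_sub_graph (Mk t te)).
Qed.

(** Let g = Pi w be the gradient, with w tangent.  Then <g, g> and <x*, g> are both
the last coordinate of w, and |g|^2 = <x*, g> <= |x*| |g|. *)
Lemma riemannian_gradient_le x i xs : S i (graph_pt f x) -> clarke_subdiff f x xs ->
  enorm (riemannian_gradient f (S i) x) <= enorm xs.
Proof.
move=> Sx Hxs; rewrite /riemannian_gradient; case: xgetP => [g _|_].
  move=> [[w Tw wg] Hg].
  have [k Ck kw] := Tw.
  have Tg : proj_tangent f (S i) x g by exists w.
  have gg : dotp g g = height w.
    rewrite -kw -(height_derive Ck); apply: (Hg _ Tg).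
    by exists k => //; rewrite kw wg.
  have := dotp_le_enorm xs g; rewrite -wg (clarke_normal Sx Hxs Tw) -gg wg -sqr_enorm.
  have [-> _|g0] := eqVneq (enorm g) 0; first exact: enorm_ge0.
  by rewrite expr2 ler_pM2r// lt0r g0 enorm_ge0.
(* The default value 0, if there is no gradient. *)
by rewrite /enorm dotp0l sqrtr0 enorm_ge0.
Qed.

End Clarke.

(** * Critical values of the last coordinate on the strata *)

Section CriticalValues.
Variables (R : realType) (n p : nat).
Local Notation E := 'rV[R]_(n + 1).
Local Notation mu := (@lebesgue_measure R).

Definition height_critical (M : set E) : set E :=
  [set u | M u /\ forall w, tangent M u w -> height w = 0].

(** If d = n + 1 then every vector is in the model space, and 'D_v phi u is sent by
the derivative of psi to v; so all vectors would be tangent, the vertical one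
included. *)
Lemma chart_dim d (M U W : set E) phi psi u : (1 <= p)%N ->
  chart p d M U W phi psi -> U u -> M u -> (d <= n + 1)%N ->
  ~ tangent M u (vertical R n) -> (d <= n)%N.
Proof.
move=> p1 Hc Uu Mu; rewrite leq_eqVlt => /orP[/eqP dE|dn _]; last by move: dn; rewrite addn1.
have [oU oW [[HU HW Cphi Cpsi] HM]] := Hc.
case; have [Wu psiu] := HU u Uu.
have dphi : differentiable phi u by exact: (Ck_on_le p1 Cphi).1.
have dpsi : differentiable psi (phi u) by exact: (Ck_on_le p1 Cpsi).1.
have -> : vertical R n = 'D_('D_(vertical R n) phi u) psi (phi u).
  rewrite -(derive_comp _ dphi dpsi) -[LHS](derive_id u).
  apply: near_eq_derive; apply: filterS (open_nbhs_nbhs (conj oU Uu)) => y Uy /=.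
  by rewrite (HU y Uy).2.
apply: (tangent_of_model p1 Hc Uu Mu) => j; rewrite dE => jn.
by have := leq_ltn_trans jn (ltn_ord j); rewrite ltnn.
Qed.

(** In the chart the last coordinate becomes the function F on an open set of R^d,
and the derivatives of F are the last coordinates of tangent vectors. *)
Lemma chart_critical_negligible d (M U W : set E) phi psi : (1 <= p)%N ->
  (n <= p)%N -> (d <= n)%N -> chart p d M U W phi psi ->
  mu.-negligible (@height R n @` (height_critical M `&` U)).
Proof.
move=> p1 np dn Hc; have [oU oW [[HU HW Cphi Cpsi] HM]] := Hc.
pose emb : 'rV[R]_d -> E := mulmxr (pid_mx d).
have cemb : continuous emb by exact: rV_linear_continuous.
have embE v (j : 'I_(n + 1)) : emb v 0 j = if insub (j : nat) is Some i then v 0 i else 0.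
  rewrite /emb /= mxE; case: insubP => [i _ ij|jd].
    rewrite (bigD1 i)//= mxE -ij eqxx ltn_ord/= mulr1 big1 ?addr0// => k ki.
    rewrite mxE -ij; case: eqP => [/val_inj kE|]; last by rewrite mulr0.
    by rewrite kE eqxx in ki.
  rewrite big1// => k _; rewrite mxE; case: eqP => [kE|]; last by rewrite mulr0.
  by rewrite -kE ltn_ord in jd.
have emb_model v : model d (emb v).
  by move=> j dj; rewrite embE insubF// ltnNge dj.
have emb_surj z : model d z -> exists v, emb v = z.
  move=> mz.
  have dn1 : (d <= n + 1)%N by rewrite addn1 ltnW.
  exists (\row_i z 0 (widen_ord dn1 i)); apply/rowP => j; rewrite embE.
  case: insubP => [i _ ij|]; first by rewrite mxE; congr (z _ _); exact: val_inj.
  by rewrite -leqNgt => dj; rewrite mz.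
pose F (w : 'rV[R]_d) : R := height (psi (emb w)).
have ch : continuous (@height R n) by exact: rV_linear_continuous.
have oW' : open (emb @^-1` W) by apply: open_comp oW => z _; exact: cemb.
have CF : Ck_on p (emb @^-1` W) F.
  exact: (Ck_on_lin_pre cemb (Ck_on_lin_post oW ch Cpsi)).
have sub : @height R n @` (height_critical M `&` U) `<=`
    F @` [set w | (emb @^-1` W) w /\ forall v, 'D_v F w = 0].
  move=> _ [u [[Mu Hu] Uu] <-]; have [Wu psiu] := HU u Uu.
  have [w0 w0E] := emb_surj (phi u) ((HM u Uu).1 Mu).
  exists w0; last by rewrite /F w0E psiu.
  split; first by rewrite /= w0E.
  move=> v.
  have dpsi : differentiable psi (phi u) by exact: (Ck_on_le p1 Cpsi).1.
  have demb : differentiable emb w0 by exact: linear_differentiable.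
  have dpe : differentiable (psi \o emb) w0.
    by apply: differentiable_comp => //; rewrite w0E.
  have dh : differentiable (@height R n) ((psi \o emb) w0) by exact: linear_differentiable.
  rewrite -[F]/(@height R n \o (psi \o emb)) (derive_comp _ dpe dh) derive_linear//.
  rewrite (derive_comp _ demb) ?w0E// derive_linear//.
  exact/Hu/(tangent_of_model p1 Hc Uu Mu).
apply: (@negligibleS _ _ _ mu _ _ sub); apply: sard CF => //.
exact: leq_trans dn np.
Qed.

Lemma height_negligible_local (C : set E) :
  (forall u, C u -> exists2 N, nbhs u N & mu.-negligible (@height R n @` (C `&` N))) ->
  mu.-negligible (@height R n @` C).
Proof.
apply: (@lindelof_ideal R (n + 1) (fun C => mu.-negligible (@height R n @` C))).
- by rewrite image_set0; exact: negligible_set0.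
- move=> F HF; have sub : @height R n @` (\bigcup_i F i) `<=` \bigcup_i (@height R n @` F i).
    by move=> _ [u [i _ Fu] <-]; exists i => //; exists u.
  by apply: (@negligibleS _ _ _ mu _ _ sub); exact: negligible_bigcup.
- move=> A B AB; apply: (@negligibleS _ _ _ mu).
  by move=> _ [u /AB Bu <-]; exists u.
Qed.

Lemma stratum_critical_negligible (M : set E) : (1 <= p)%N -> (n <= p)%N ->
  submanifold p M -> (forall u, M u -> ~ tangent M u (vertical R n)) ->
  mu.-negligible (@height R n @` height_critical M).
Proof.
move=> p1 np [d dm HM] vert; apply: height_negligible_local => u [Mu _].
have [U [W [phi [psi [[oU Uu oW] H2]]]]] := HM u Mu.
have Hc : chart p d M U W phi psi by [].
exists U; first exact: open_nbhs_nbhs.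
exact: chart_critical_negligible p1 np (chart_dim p1 Hc Uu Mu dm (vert u Mu)) Hc.
Qed.

(** There may be uncountably many indices a priori; only finitely many strata matter
near each point, and [lindelof_ideal] does the rest. *)
Lemma strata_critical_negligible (X : set E) (I : Type) (S : I -> set E) :
  (1 <= p)%N -> (n <= p)%N -> stratification p X S ->
  (forall i u, S i u -> ~ tangent (S i) u (vertical R n)) ->
  mu.-negligible (@height R n @` [set u | exists i, height_critical (S i) u]).
Proof.
move=> p1 np [[covS _ _] locf HS _] vert.
apply: height_negligible_local => u [i [Si _]].
have Xu : X u by rewrite -covS; exists i.
have [N nN finN] := locf u Xu; exists N => //.
have [k [e He]] := finite_set_enum finN.
have sub : @height R n @` ([set u | exists i, height_critical (S i) u] `&` N) `<=`
    \bigcup_r (if e r is Some i then @height R n @` height_critical (S i) else set0).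
  move=> _ [v [[j Cv] Nv] <-].
  have [|r _ er] := He j; first by exists v; split => //; exact: Cv.1.
  by exists r => //; rewrite er; exists v.
apply: (@negligibleS _ _ _ mu _ _ sub); apply: negligible_bigcup => r.
case: (e r) => [j|]; last exact: negligible_set0.
by apply: stratum_critical_negligible => //; exact: vert.
Qed.

End CriticalValues.

Theorem corollary5 (R : realType) (n p : nat) (f : 'rV[R]_n -> \bar R)
    (I : Type) (S : I -> set 'rV[R]_(n + 1))
    (hp : (1 <= p)%N)
    (hf : forall x, f x != -oo%E)
    (hlsc : lsc f)
    (hclosed : closed (graph f))
    (hS : whitney_stratification p (graph f) S)
    (hvert : forall i u, S i u -> ~ tangent (S i) u (vertical R n)) :
  (forall x, clarke_subdiff f x !=set0 ->
    forall xs, clarke_subdiff f x xs ->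
    forall i, S i (graph_pt f x) ->
      enorm (riemannian_gradient f (S i) x) <= enorm xs)
  /\
  ((n <= p)%N ->
    (@lebesgue_measure R).-negligible (clarke_critical_values f)).
Proof.
split=> [x _ xs Hxs i Sx|np]; first exact: riemannian_gradient_le hp hf hS _ _ _ Sx Hxs.
have sub : clarke_critical_values f `<=`
    @height R n @` [set u | exists i, height_critical (S i) u].
  move=> a [x [fa H0]].
  have dx : dom f x by rewrite /dom /= fa ltry.
  have : graph f (graph_pt f x) by exists x.
  have [[[covS _ _] _ _ _] _] := hS; rewrite -covS => -[i _ Sx].
  exists (graph_pt f x); last by rewrite /graph_pt height_pt fa.
  exists i; split => // w Tw.
  by rewrite -(clarke_normal hp hf hS Sx H0 Tw) dotp0l.
apply: (@negligibleS _ _ _ (@lebesgue_measure R) _ _ sub).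
exact: strata_critical_negligible hp np hS.1 hvert.
Qed.
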